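(* Let $\mathbb{C}$ and $\mathbb{C}'$ be balanced orean bicategories, the first of which has finite colimits, a terminal object, and pullbacks. If there is a faithful functor $T\colon\mathbb{C}\to\mathbb{C}'$ which preserves finite colimits, the terminal object, monomorphisms, as well as pullbacks of epimorphisms along arbitrary morphisms, and $\mathbb{C}'$ has an emd-noetherian form (a noetherian form admitting an exact meet decomposition), then $\mathbb{C}$ has an emd-noetherian form.
   Context: Bicategories. A bicategory here is a triple $(\mathbb{C},\mathcal{E},\mathcal{M})$ with $\mathbb{C}$ a category and $\mathcal{E},\mathcal{M}$ classes of morphisms of $\mathbb{C}$. It is an orean bicategory if $(\mathcal{E},\mathcal{M})$ is a proper factorization system (a factorization system with $\mathcal{E}$ consisting of epimorphisms and $\mathcal{M}$ of monomorphisms) such that pushouts of morphisms in $\mathcal{E}$ and pullbacks of morphisms in $\mathcal{M}$ along arbitrary morphisms exist, and finite (including empty) meets and joins of $\mathcal{E}$-quotients and of $\mathcal{M}$-subobjects of each object exist. It is balanced if $\mathcal{E}$ is the class of all epimorphisms and $\mathcal{M}$ is the class of all monomorphisms of $\mathbb{C}$. The same letter is used for a bicategory and its underlying category; emd-noetherian forms are noetherian forms over the underlying category. Forms. A form over a category $\mathbb{C}$ is a faithful functor $F\colon\mathbb{B}\to\mathbb{C}$ that is amnestic (an isomorphism of $\mathbb{B}$ sent to an identity morphism is an identity morphism). Objects of $\mathbb{B}$ sent to $X$ are called ($F$-)clusters in $X$. For $f\colon X\to Y$, a cluster $A$ in $X$ and a cluster $B$ in $Y$, $B\geq_f A$ means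 that some morphism $A\to B$ of $\mathbb{B}$ is sent to $f$; $\geq$ denotes $\geq_{1_X}$, a partial order on the clusters in $X$. $F$ is orean if: (O1) for each $X$ the clusters in $X$ form a bounded lattice ($\bot_X,\top_X,\vee,\wedge$); (O2) for $f\colon X\to Y$, $g\colon Y\to Z$, if $C\geq_{gf}A$ then there is a cluster $B$ in $Y$ with $C\geq_g B$ and $B\geq_f A$; (O3) for $f\colon X\to Y$ and a cluster $S$ in $X$ there is a least cluster $f\cdot S$ in $Y$ among those $T$ with $T\geq_f S$, and for a cluster $T$ in $Y$ there is a largest cluster $T\cdot f$ in $X$ among those $S$ with $T\geq_f S$. For $f\colon X\to Y$ put $\mathrm{Im} f=f\cdot\top_X$, $\mathrm{Ker} f=\bot_Y\cdot f$. A cluster is conormal (normal) if it is the image (kernel) of some morphism. An orean form is conormal (normal) if all its clusters are. Operators. An operator $\tau\colon F\to G$ between forms over $\mathbb{C}$ is a map of clusters over each object such that $B\geq_f A$ implies $\tau B\geq_f\tau A$. A collection of $F$-clusters, with the relations $\geq_f$ restricted, is a subform of $F$. For an idempotent operator $\tau\colon F\to F$, $F_\tau$ is the subform of clusters $S$ with $\tau S=S$. An operator of orean forms is conormal if $\tau(\mathrm{Im}^F f)=\mathrm{Im}^G f$ for all $f$, normal if $\tau(\mathrm{Ker}^F f)=\mathrm{Ker}^G f$ for all $f$, binormal if both. Noetherian forms. For an orean form, an embedding of a conormal cluster $S$ in $X$ is a morphism $m\colon W\to X$ with $\mathrm{Im}\, m=S$ such that every $m'\colon W'\to X$ with $\mathrm{Im}\,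 m'\leq S$ factors uniquely as $m'=mg$. A quotient of a normal cluster $S$ in $X$ is a morphism $q\colon X\to Y$ with $\mathrm{Ker}\, q=S$ such that every $q'\colon X\to Y'$ with $\mathrm{Ker}\, q'\geq S$ factors uniquely as $q'=hq$. An orean form is noetherian if: (N1) for every $f\colon X\to Y$, $(f\cdot S)\cdot f=S\vee\mathrm{Ker} f$ for all clusters $S$ in $X$, and $f\cdot(T\cdot f)=T\wedge\mathrm{Im} f$ for all clusters $T$ in $Y$; (N2) every morphism $f$ factors as $f=me$ with $m$ an embedding of $\mathrm{Im} f$ and $e$ a quotient of $\mathrm{Ker} f$; (N3) the join of two normal clusters is normal and the meet of two conormal clusters is conormal. Exact meet decomposition. A meet decomposition of an orean form $F$ is a pair $(\kappa_s,\kappa_e)$ of idempotent operators $F\to F$ such that $F_s=F_{\kappa_s}$ is a conormal orean form, $F_e=F_{\kappa_e}$ is a normal orean form, and $S=\kappa_s S\wedge\kappa_e S$ for every cluster $S$. It is exact if the restrictions $\tau_s\colon F\to F_s$, $\tau_e\colon F\to F_e$ of $\kappa_s,\kappa_e$ are binormal, there exist a conormal operator $F_s\to F_e$ and a normal operator $F_e\to F_s$, the subform inclusion $F_s\to F$ is conormal and the subform inclusion $F_e\to F$ is normal. *)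

(* Defs.v *)
From Stdlib Require Import List FinFun ProofIrrelevance.

Set Implicit Arguments.
Unset Strict Implicit.
Unset Printing Implicit Defensive.
#[local] Obligation Tactic := idtac.

Declare Scope cat_scope.
Open Scope cat_scope.

Record category := Category {
  ob :> Type;
  hom : ob -> ob -> Type;
  idm : forall X, hom X X;
  comp : forall X Y Z, hom Y Z -> hom X Y -> hom X Z;
  comp_assoc : forall X Y Z W (h : hom Z W) (g : hom Y Z) (f : hom X Y),
    comp h (comp g f) = comp (comp h g) f;
  comp_id_l : forall X Y (f : hom X Y), comp (idm Y) f = f;
  comp_id_r : forall X Y (f : hom X Y), comp f (idm X) = f
}.

Arguments hom {c} X Y.
Arguments idm {c} X.
Arguments comp {c X Y Z} g f.
Notation "g ∘ f" := (comp g f) (at level 40, left associativity) : cat_scope.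

Record functor (C D : category) := Functor {
  fob :> C -> D;
  fmap : forall X Y, hom X Y -> hom (fob X) (fob Y);
  fmap_id : forall X, fmap (idm X) = idm (fob X);
  fmap_comp : forall X Y Z (g : hom Y Z) (f : hom X Y),
    fmap (g ∘ f) = fmap g ∘ fmap f
}.

Arguments fmap {C D} _ {X Y} _.

Program Definition functor_comp (C D E : category) (G : functor D E)
    (F : functor C D) : functor C E :=
  {| fob := fun X => G (F X); fmap := fun X Y f => fmap G (fmap F f) |}.
Next Obligation. intros; simpl; now rewrite !fmap_id. Qed.
Next Obligation. intros; simpl; now rewrite !fmap_comp. Qed.

Definition faithful (C D : category) (F : functor C D) :=
  forall X Y (f g : hom X Y), fmap F f = fmap F g -> f = g.

Section Morphisms.
Context {C : category}.

Definition mono (X Y : C) (m : hom X Y) :=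
  forall W (f g : hom W X), m ∘ f = m ∘ g -> f = g.

Definition epi (X Y : C) (e : hom X Y) :=
  forall Z (f g : hom Y Z), f ∘ e = g ∘ e -> f = g.

Definition iso (X Y : C) (f : hom X Y) :=
  exists g : hom Y X, g ∘ f = idm X /\ f ∘ g = idm Y.

Inductive is_identity (X : C) : forall Y, hom X Y -> Prop :=
  is_identity_idm : is_identity (idm X).

Definition hom_cast (X X' Y Y' : C) (eX : X = X') (eY : Y = Y')
    (f : hom X Y) : hom X' Y' :=
  match eX in _ = X1, eY in _ = Y1 return hom X1 Y1 with
  | eq_refl, eq_refl => f
  end.

Definition is_terminal (X : C) := forall W, exists! f : hom W X, True.

Definition is_pullback (P X Y Z : C) (f : hom X Z) (g : hom Y Z)
    (p : hom P X) (q : hom P Y) :=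
  f ∘ p = g ∘ q /\
  forall W (u : hom W X) (v : hom W Y), f ∘ u = g ∘ v ->
    exists! h : hom W P, p ∘ h = u /\ q ∘ h = v.

Definition is_pushout (P X Y Z : C) (f : hom Z X) (g : hom Z Y)
    (p : hom X P) (q : hom Y P) :=
  p ∘ f = q ∘ g /\
  forall W (u : hom X W) (v : hom Y W), u ∘ f = v ∘ g ->
    exists! h : hom P W, h ∘ p = u /\ h ∘ q = v.

Definition is_colimit (J : category) (D : functor J C) (L : C)
    (leg : forall j, hom (D j) L) :=
  (forall i j (a : hom i j), leg j ∘ fmap D a = leg i) /\
  forall (W : C) (leg' : forall j, hom (D j) W),
    (forall i j (a : hom i j), leg' j ∘ fmap D a = leg' i) ->
    exists! h : hom L W, forall j, h ∘ leg j = leg' j.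
End Morphisms.

Definition finite_category (J : category) :=
  Finite J /\ forall i j : J, Finite (hom i j).

Definition has_finite_colimits (C : category) :=
  forall (J : category) (D : functor J C), finite_category J ->
    exists (L : C) (leg : forall j, hom (D j) L), is_colimit leg.

Definition has_terminal (C : category) := exists X : C, is_terminal X.

Definition has_pullbacks (C : category) :=
  forall (X Y Z : C) (f : hom X Z) (g : hom Y Z),
    exists (P : C) (p : hom P X) (q : hom P Y), is_pullback f g p q.

Section Preservation.
Variables (C D : category) (T : functor C D).

Definition preserves_finite_colimits :=
  forall (J : category) (E : functor J C) (L : C) (leg : forall j, hom (E j) L),
    finite_category J -> is_colimit leg ->
    is_colimit (D := functor_comp T E) (fun j => fmap T (leg j)).

Definition preserves_terminal :=
  forall X : C, is_terminal X -> is_terminal (T X).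

Definition preserves_monos :=
  forall (X Y : C) (m : hom X Y), mono m -> mono (fmap T m).

Definition preserves_pullbacks_of_epis :=
  forall (P X Y Z : C) (f : hom X Z) (g : hom Y Z) (p : hom P X) (q : hom P Y),
    epi f -> is_pullback f g p q ->
    is_pullback (fmap T f) (fmap T g) (fmap T p) (fmap T q).
End Preservation.

(* Not to be confused with weak 2-categories: here a bicategory is a category
   with two distinguished classes of morphisms. *)
Record bicategory := Bicategory {
  bicat :> category;
  Ecl : forall X Y : bicat, hom X Y -> Prop;
  Mcl : forall X Y : bicat, hom X Y -> Prop
}.

Arguments Ecl {b X Y} f.
Arguments Mcl {b X Y} f.

(* Meets and joins of arbitrary finite families, the empty one included, in a
   preorder; they represent the meets and joins of the quotient poset. *)
Definition has_finite_meets (T : Type) (le : T -> T -> Prop) :=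
  forall l : list T, exists m, (forall x, In x l -> le m x) /\
    forall z, (forall x, In x l -> le z x) -> le z m.

Definition has_finite_joins (T : Type) (le : T -> T -> Prop) :=
  has_finite_meets (fun x y => le y x).

Section Bicategories.
Variable C : bicategory.

Record factorization_system : Prop := {
  iso_E : forall (X Y : C) (f : hom X Y), iso f -> Ecl f;
  iso_M : forall (X Y : C) (f : hom X Y), iso f -> Mcl f;
  comp_E : forall (X Y Z : C) (g : hom Y Z) (f : hom X Y),
    Ecl g -> Ecl f -> Ecl (g ∘ f);
  comp_M : forall (X Y Z : C) (g : hom Y Z) (f : hom X Y),
    Mcl g -> Mcl f -> Mcl (g ∘ f);
  EM_factor : forall (X Y : C) (f : hom X Y),
    exists (I : C) (e : hom X I) (m : hom I Y), Ecl e /\ Mcl m /\ f = m ∘ e;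
  EM_diagonal : forall (A B X Y : C) (e : hom A B) (m : hom X Y)
      (u : hom A X) (v : hom B Y),
    Ecl e -> Mcl m -> m ∘ u = v ∘ e ->
    exists! d : hom B X, d ∘ e = u /\ m ∘ d = v
}.

(* Representatives of the M-subobjects and of the E-quotients of X. *)
Record subobject (X : C) := Subobject {
  sub_ob : C;
  sub_map : hom sub_ob X;
  sub_M : Mcl sub_map
}.

Definition sub_le (X : C) (m n : subobject X) :=
  exists g : hom (sub_ob m) (sub_ob n), sub_map m = sub_map n ∘ g.

Record quotient (X : C) := Quotient {
  quo_ob : C;
  quo_map : hom X quo_ob;
  quo_E : Ecl quo_map
}.

Definition quo_le (X : C) (d e : quotient X) :=
  exists g : hom (quo_ob d) (quo_ob e), quo_map e = g ∘ quo_map d.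

Record orean_bicategory : Prop := {
  orean_fs : factorization_system;
  E_epi : forall (X Y : C) (e : hom X Y), Ecl e -> epi e;
  M_mono : forall (X Y : C) (m : hom X Y), Mcl m -> mono m;
  E_pushouts : forall (X Y Z : C) (e : hom Z X) (f : hom Z Y), Ecl e ->
    exists (P : C) (p : hom X P) (q : hom Y P), is_pushout e f p q;
  M_pullbacks : forall (X Y Z : C) (m : hom X Z) (f : hom Y Z), Mcl m ->
    exists (P : C) (p : hom P X) (q : hom P Y), is_pullback m f p q;
  quo_meets : forall X : C, has_finite_meets (@quo_le X);
  quo_joins : forall X : C, has_finite_joins (@quo_le X);
  sub_meets : forall X : C, has_finite_meets (@sub_le X);
  sub_joins : forall X : C, has_finite_joins (@sub_le X)
}.

Definition balanced :=
  (forall (X Y : C) (f : hom X Y), Ecl f <-> epi f) /\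
  (forall (X Y : C) (f : hom X Y), Mcl f <-> mono f).
End Bicategories.

Record form (C : category) := Form {
  form_cat : category;
  form_fun : functor form_cat C;
  form_faithful : faithful form_fun;
  form_amnestic : forall (A B : form_cat) (i : hom A B),
    iso i -> is_identity (fmap form_fun i) -> is_identity i
}.

Definition cluster (C : category) (F : form C) (X : C) :=
  {A : form_cat F | form_fun F A = X}.

(* [ge_along f T S] is T >=_f S and [ge T S] is T >= S. *)
Definition ge_along (C : category) (F : form C) (X Y : C) (f : hom X Y)
    (T : cluster F Y) (S : cluster F X) :=
  exists phi : hom (proj1_sig S) (proj1_sig T),
    hom_cast (proj2_sig S) (proj2_sig T) (fmap (form_fun F) phi) = f.

Definition ge (C : category) (F : form C) (X : C) (T S : cluster F X) :=
  ge_along (idm X) T S.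

(* The operations are determined by their laws since [ge] is antisymmetric, so
   a form carries at most one orean structure. *)
Record orean (C : category) (F : form C) := Orean {
  bot : forall X, cluster F X;
  top : forall X, cluster F X;
  join : forall X, cluster F X -> cluster F X -> cluster F X;
  meet : forall X, cluster F X -> cluster F X -> cluster F X;
  dir : forall X Y, hom X Y -> cluster F X -> cluster F Y;
  inv : forall X Y, hom X Y -> cluster F Y -> cluster F X;
  bot_least : forall X (S : cluster F X), ge S (bot X);
  top_greatest : forall X (S : cluster F X), ge (top X) S;
  join_l : forall X (S T : cluster F X), ge (join S T) S;
  join_r : forall X (S T : cluster F X), ge (join S T) T;
  join_least : forall X (S T U : cluster F X),
    ge U S -> ge U T -> ge U (join S T);
  meet_l : forall X (S T : cluster F X), ge S (meet S T);
  meet_r : forall X (S T : cluster F X), ge T (meet S T);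
  meet_greatest : forall X (S T U : cluster F X),
    ge S U -> ge T U -> ge (meet S T) U;
  ge_interpolate : forall X Y Z (f : hom X Y) (g : hom Y Z)
      (A : cluster F X) (D : cluster F Z),
    ge_along (g ∘ f) D A ->
    exists B : cluster F Y, ge_along g D B /\ ge_along f B A;
  dir_ge : forall X Y (f : hom X Y) (S : cluster F X), ge_along f (dir f S) S;
  dir_least : forall X Y (f : hom X Y) (S : cluster F X) (T : cluster F Y),
    ge_along f T S -> ge T (dir f S);
  inv_ge : forall X Y (f : hom X Y) (T : cluster F Y), ge_along f T (inv f T);
  inv_greatest : forall X Y (f : hom X Y) (S : cluster F X) (T : cluster F Y),
    ge_along f T S -> ge (inv f T) S
}.

Arguments bot {C F} o X.
Arguments top {C F} o X.
Arguments join {C F} o {X} S T.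
Arguments meet {C F} o {X} S T.
Arguments dir {C F} o {X Y} f S.
Arguments inv {C F} o {X Y} f T.

Section OreanForms.
Context (C : category) (F : form C) (O : orean F).

Definition Im (X Y : C) (f : hom X Y) : cluster F Y := dir O f (top O X).
Definition Ker (X Y : C) (f : hom X Y) : cluster F X := inv O f (bot O Y).

Definition conormal_cluster (X : C) (S : cluster F X) :=
  exists (W : C) (f : hom W X), Im f = S.
Definition normal_cluster (X : C) (S : cluster F X) :=
  exists (Y : C) (f : hom X Y), Ker f = S.

Definition conormal_form := forall X (S : cluster F X), conormal_cluster S.
Definition normal_form := forall X (S : cluster F X), normal_cluster S.

Definition is_embedding (X W : C) (S : cluster F X) (m : hom W X) :=
  Im m = S /\
  forall W' (m' : hom W' X), ge S (Im m') -> exists! g : hom W' W, m' = m ∘ g.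

Definition is_quotient (X Y : C) (S : cluster F X) (q : hom X Y) :=
  Ker q = S /\
  forall Y' (q' : hom X Y'), ge (Ker q') S -> exists! h : hom Y Y', q' = h ∘ q.

Record noetherian : Prop := {
  inv_dir : forall X Y (f : hom X Y) (S : cluster F X),
    inv O f (dir O f S) = join O S (Ker f);
  dir_inv : forall X Y (f : hom X Y) (T : cluster F Y),
    dir O f (inv O f T) = meet O T (Im f);
  noetherian_factor : forall X Y (f : hom X Y),
    exists (I : C) (m : hom I Y) (e : hom X I),
      is_embedding (Im f) m /\ is_quotient (Ker f) e /\ f = m ∘ e;
  join_normal : forall X (S T : cluster F X),
    normal_cluster S -> normal_cluster T -> normal_cluster (join O S T);
  meet_conormal : forall X (S T : cluster F X),
    conormal_cluster S -> conormal_cluster T -> conormal_cluster (meet O S T)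
}.
End OreanForms.

Record operator (C : category) (F G : form C) := Operator {
  op :> forall X, cluster F X -> cluster G X;
  op_ge : forall X Y (f : hom X Y) (S : cluster F X) (T : cluster F Y),
    ge_along f T S -> ge_along f (op T) (op S)
}.

Arguments op {C F G} o {X} S.

Section OperatorProperties.
Context (C : category) (F G : form C) (OF : orean F) (OG : orean G).
Variable tau : operator F G.

Definition conormal_operator :=
  forall X Y (f : hom X Y), tau Y (Im OF f) = Im OG f.
Definition normal_operator :=
  forall X Y (f : hom X Y), tau X (Ker OF f) = Ker OG f.
Definition binormal_operator := conormal_operator /\ normal_operator.
End OperatorProperties.

Section Subforms.
Context (C : category) (F : form C).

Definition cluster_of (A : form_cat F) : cluster F (form_fun F A) :=
  exist _ A eq_refl.

Variable P : forall X, cluster F X -> Prop.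

Program Definition subform_cat : category := {|
  ob := {A : form_cat F | P (cluster_of A)};
  hom := fun A B => hom (proj1_sig A) (proj1_sig B);
  idm := fun A => idm (proj1_sig A);
  comp := fun A B D g f => g ∘ f
|}.
Next Obligation. intros; apply comp_assoc. Qed.
Next Obligation. intros; apply comp_id_l. Qed.
Next Obligation. intros; apply comp_id_r. Qed.

Program Definition subform_fun : functor subform_cat C := {|
  fob := fun A => form_fun F (proj1_sig A);
  fmap := fun A B f => fmap (form_fun F) f
|}.
Next Obligation. intros; apply (fmap_id (form_fun F)). Qed.
Next Obligation. intros; apply (fmap_comp (form_fun F)). Qed.

Program Definition subform : form C := {| form_fun := subform_fun |}.
Next Obligation. intros A B f g E; exact (form_faithful E). Qed.
Next Obligation.
intros [A PA] [B PB] i Hi Hid; simpl in i.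
pose proof (form_amnestic (f := F) (i := i) Hi Hid) as H; clear Hi Hid.
destruct H.
rewrite (proof_irrelevance _ PB PA); exact (@is_identity_idm subform_cat (exist _ A PA)).
Qed.

Lemma cluster_ofP X (S : cluster F X) : P S -> P (cluster_of (proj1_sig S)).
Proof. destruct S as [A e]; destruct e; exact (fun p => p). Qed.

Definition subform_cluster X (S : cluster F X) (p : P S) : cluster subform X :=
  exist (fun A : subform_cat => subform_fun A = X)
    (exist _ (proj1_sig S) (cluster_ofP p)) (proj2_sig S).

Program Definition inclusion : operator subform F := {|
  op := fun X S => exist _ (proj1_sig (proj1_sig S)) (proj2_sig S)
|}.
Next Obligation. exact (fun X Y f S T h => h). Qed.

Program Definition corestrict (G : form C) (tau : operator G F)
    (h : forall X (S : cluster G X), P (tau X S)) : operator G subform := {|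
  op := fun X S => subform_cluster (h X S)
|}.
Next Obligation. exact (fun G tau h X Y f S T => @op_ge _ _ _ tau X Y f S T). Qed.
End Subforms.

Definition idempotent_operator (C : category) (F : form C)
    (kappa : operator F F) :=
  forall X (S : cluster F X), kappa X (kappa X S) = kappa X S.

Definition fixed_form (C : category) (F : form C) (kappa : operator F F) :=
  subform (fun X (S : cluster F X) => kappa X S = S).

Definition fixed_inclusion (C : category) (F : form C) (kappa : operator F F) :
  operator (fixed_form kappa) F := inclusion _.

Definition fixed_restriction (C : category) (F : form C) (kappa : operator F F)
    (h : idempotent_operator kappa) : operator F (fixed_form kappa) :=
  corestrict h.

Record meet_decomposition (C : category) (F : form C) (O : orean F) := {
  kappa_s : operator F F;
  kappa_e : operator F F;
  kappa_s_idem : idempotent_operator kappa_s;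
  kappa_e_idem : idempotent_operator kappa_e;
  orean_s : orean (fixed_form kappa_s);
  orean_e : orean (fixed_form kappa_e);
  conormal_s : conormal_form orean_s;
  normal_e : normal_form orean_e;
  meet_decomp : forall X (S : cluster F X),
    S = meet O (kappa_s X S) (kappa_e X S)
}.

Definition exact_decomposition (C : category) (F : form C) (O : orean F)
    (K : meet_decomposition O) :=
  binormal_operator O (orean_s K) (fixed_restriction (kappa_s_idem K)) /\
  binormal_operator O (orean_e K) (fixed_restriction (kappa_e_idem K)) /\
  (exists tau : operator (fixed_form (kappa_s K)) (fixed_form (kappa_e K)),
     conormal_operator (orean_s K) (orean_e K) tau) /\
  (exists tau : operator (fixed_form (kappa_e K)) (fixed_form (kappa_s K)),
     normal_operator (orean_e K) (orean_s K) tau) /\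
  conormal_operator (orean_s K) O (fixed_inclusion (kappa_s K)) /\
  normal_operator (orean_e K) O (fixed_inclusion (kappa_e K)).

Definition has_emd_noetherian_form (C : category) :=
  exists (F : form C) (O : orean F), noetherian O /\
    exists K : meet_decomposition O, exact_decomposition K.

(* Main.v *)
(** The form on [C] is cut out of the given form [F] on [C'].  Its clusters in
    [X] are the [F]-clusters [A] in [T X] whose two closures [ks A] and [ke A]
    are [Im (T k)] and [Ker (T g)] for some [k] and [g] in [C]; [f] relates two
    of them when [T f] does.  Faithfulness, balancedness and preservation of
    finite colimits make [T] reflect the order of subobjects and of quotients.
    Every meet [Ker (T g) /\ Im (T k)] is again such a cluster: it is the direct
    image along [T k] of [Ker (T (g k))], its [ke] is computed by a pushout and
    its [ks] by pulling back the least subobject along an epimorphism.  So direct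
    images and joins are those of [F], whereas meets and inverse images, which
    [T] need not preserve, are [Ker (T g) /\ Im (T k)] with [g] and [k] computed
    in [C].  Inverse images along [T f] of clusters below [Im (T f)] do stay in
    the form, which yields the noetherian axioms. *)

From Stdlib Require Import List FinFun ProofIrrelevance IndefiniteDescription.
Require Import Defs.

Set Implicit Arguments.
Unset Strict Implicit.
Unset Printing Implicit Defensive.

(** * Forms over a category *)

Section Clusters.
Context (C : category) (F : form C).

Lemma ge_refl X (S : cluster F X) : ge S S.
Proof.
destruct S as [A e]; destruct e.
exists (idm A); apply (fmap_id (form_fun F)).
Qed.

Lemma ge_along_comp X Y Z (g : hom Y Z) (f : hom X Y)
    (U : cluster F Z) (T : cluster F Y) (S : cluster F X) :
  ge_along g U T -> ge_along f T S -> ge_along (g ∘ f) U S.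
Proof.
destruct S as [A eA], T as [B eB], U as [D eD]; destruct eA, eB, eD.
intros [psi Hpsi] [phi Hphi]; exists (psi ∘ phi); simpl in *.
now rewrite fmap_comp, Hpsi, Hphi.
Qed.

Lemma ge_along_trans_l X Y (f : hom X Y) (U T : cluster F Y) (S : cluster F X) :
  ge U T -> ge_along f T S -> ge_along f U S.
Proof.
intros H1 H2; rewrite <- (comp_id_l f); exact (ge_along_comp H1 H2).
Qed.

Lemma ge_along_trans_r X Y (f : hom X Y) (U : cluster F Y) (T S : cluster F X) :
  ge_along f U T -> ge T S -> ge_along f U S.
Proof.
intros H1 H2; rewrite <- (comp_id_r f); exact (ge_along_comp H1 H2).
Qed.

Lemma ge_trans X (U T S : cluster F X) : ge U T -> ge T S -> ge U S.
Proof. exact (@ge_along_trans_l X X (idm X) U T S). Qed.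

Lemma hom_cast_is_identity (A B X : C) (eA : A = X) (eB : B = X) (f : hom A B) :
  hom_cast eA eB f = idm X -> is_identity f.
Proof. destruct eA, eB; simpl; intros ->; constructor. Qed.

Lemma hom_cast_inverse (A B X : C) (eA : A = X) (eB : B = X)
    (f : hom A B) (g : hom B A) :
  hom_cast eA eB f = idm X -> hom_cast eB eA g = idm X -> g ∘ f = idm A.
Proof. destruct eA, eB; simpl; intros -> ->; apply comp_id_l. Qed.

(** By faithfulness the two comparison morphisms are mutually inverse, so [phi] is an isomorphism
    over an identity, and amnesticity turns it into an identity. *)
Lemma ge_antisym X (S T : cluster F X) : ge S T -> ge T S -> S = T.
Proof.
destruct S as [A eA], T as [B eB]; intros [psi Hpsi] [phi Hphi]; simpl in *.
assert (Hid : is_identity phi).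
{ apply (form_amnestic (f := F)).
  - exists psi; split; apply (form_faithful (f := F));
      rewrite fmap_comp, fmap_id;
      eapply hom_cast_inverse; eassumption.
  - eapply hom_cast_is_identity; eassumption. }
clear Hphi Hpsi psi; destruct Hid.
now rewrite (proof_irrelevance _ eA eB).
Qed.

Lemma eq_ge X (S T : cluster F X) : S = T -> ge S T.
Proof. intros ->; apply ge_refl. Qed.

(** The direct image clause asks for a universal property after every further [g]. Taking [g] an
    identity gives leastness, and a general [g] gives (O2) with the direct image as interpolating
    cluster. *)
Lemma orean_of_exists :
  (forall X, exists b : cluster F X, forall S, ge S b) ->
  (forall X, exists t : cluster F X, forall S, ge t S) ->
  (forall X (S T : cluster F X), exists J,
     ge J S /\ ge J T /\ forall U, ge U S -> ge U T -> ge U J) ->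
  (forall X (S T : cluster F X), exists M,
     ge S M /\ ge T M /\ forall U, ge S U -> ge T U -> ge M U) ->
  (forall X Y (f : hom X Y) (S : cluster F X), exists D,
     ge_along f D S /\
     forall Z (g : hom Y Z) U, ge_along (g ∘ f) U S -> ge_along g U D) ->
  (forall X Y (f : hom X Y) (T : cluster F Y), exists I,
     ge_along f T I /\ forall S, ge_along f T S -> ge I S) ->
  inhabited (orean F).
Proof.
intros Hb Ht Hj Hm Hd Hi; constructor.
pose (pick := constructive_indefinite_description).
refine (Orean
  (bot := fun X => proj1_sig (pick _ _ (Hb X)))
  (top := fun X => proj1_sig (pick _ _ (Ht X)))
  (join := fun X S T => proj1_sig (pick _ _ (Hj X S T)))
  (meet := fun X S T => proj1_sig (pick _ _ (Hm X S T)))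
  (dir := fun X Y f S => proj1_sig (pick _ _ (Hd X Y f S)))
  (inv := fun X Y f T => proj1_sig (pick _ _ (Hi X Y f T))) _ _ _ _ _ _ _ _ _ _ _ _ _).
- intros X; apply (proj2_sig (pick _ _ (Hb X))).
- intros X; apply (proj2_sig (pick _ _ (Ht X))).
- intros X S T; apply (proj2_sig (pick _ _ (Hj X S T))).
- intros X S T; apply (proj2_sig (pick _ _ (Hj X S T))).
- intros X S T; apply (proj2_sig (pick _ _ (Hj X S T))).
- intros X S T; apply (proj2_sig (pick _ _ (Hm X S T))).
- intros X S T; apply (proj2_sig (pick _ _ (Hm X S T))).
- intros X S T; apply (proj2_sig (pick _ _ (Hm X S T))).
- intros X Y Z f g A D H; destruct (Hd X Y f A) as (B & H1 & H2).
  exists B; split; auto.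
- intros X Y f S; apply (proj2_sig (pick _ _ (Hd X Y f S))).
- intros X Y f S T H; apply (proj2_sig (pick _ _ (Hd X Y f S))).
  now rewrite comp_id_l.
- intros X Y f T; apply (proj2_sig (pick _ _ (Hi X Y f T))).
- intros X Y f S T; apply (proj2_sig (pick _ _ (Hi X Y f T))).
Qed.
End Clusters.

(** * Direct and inverse images in an orean form *)

Section Orean.
Context (C : category) (F : form C) (O : orean F).

Lemma ge_along_of_dir X Y (f : hom X Y) (S : cluster F X) (T : cluster F Y) :
  ge T (dir O f S) -> ge_along f T S.
Proof. intros H; exact (ge_along_trans_l H (dir_ge O f S)). Qed.

Lemma ge_along_of_inv X Y (f : hom X Y) (S : cluster F X) (T : cluster F Y) :
  ge (inv O f T) S -> ge_along f T S.
Proof. exact (ge_along_trans_r (inv_ge O f T)). Qed.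

Lemma ge_along_meet X Y (f : hom X Y) (S : cluster F X) (T U : cluster F Y) :
  ge_along f T S -> ge_along f U S -> ge_along f (meet O T U) S.
Proof.
intros H1 H2; apply ge_along_of_dir.
apply meet_greatest; apply dir_least; assumption.
Qed.

Lemma ge_along_dir_comp X Y Z (f : hom X Y) (g : hom Y Z)
    (S : cluster F X) (U : cluster F Z) :
  ge_along (g ∘ f) U S -> ge_along g U (dir O f S).
Proof.
intros H; destruct (ge_interpolate O H) as (B & H1 & H2).
exact (ge_along_trans_r H1 (dir_least O H2)).
Qed.

Lemma dir_comp X Y Z (f : hom X Y) (g : hom Y Z) (S : cluster F X) :
  dir O (g ∘ f) S = dir O g (dir O f S).
Proof.
apply ge_antisym.
- apply dir_least, ge_along_dir_comp, dir_ge.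
- apply dir_least, ge_along_comp with (T := dir O f S); apply dir_ge.
Qed.

Lemma inv_comp X Y Z (f : hom X Y) (g : hom Y Z) (U : cluster F Z) :
  inv O (g ∘ f) U = inv O f (inv O g U).
Proof.
apply ge_antisym.
- apply inv_greatest, ge_along_comp with (T := inv O g U); apply inv_ge.
(* The interpolating cluster [B] lies below [inv O g U], so its inverse image along [f] is below the
   iterated one. *)
- destruct (ge_interpolate O (inv_ge O (g ∘ f) U)) as (B & H1 & H2).
  apply inv_greatest, ge_along_trans_l with (T := B); trivial.
  now apply inv_greatest.
Qed.

Lemma dir_mono X Y (f : hom X Y) (S T : cluster F X) :
  ge T S -> ge (dir O f T) (dir O f S).
Proof.
intros H; apply dir_least, ge_along_trans_r with (T := T); trivial.
apply dir_ge.
Qed.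

Lemma inv_mono X Y (f : hom X Y) (S T : cluster F Y) :
  ge T S -> ge (inv O f T) (inv O f S).
Proof.
intros H; apply inv_greatest, ge_along_trans_l with (T := S); trivial.
apply inv_ge.
Qed.

Lemma inv_meet X Y (f : hom X Y) (S T : cluster F Y) :
  inv O f (meet O S T) = meet O (inv O f S) (inv O f T).
Proof.
apply ge_antisym.
- apply inv_greatest, ge_along_meet; apply ge_along_of_inv;
    [apply meet_l | apply meet_r].
- apply meet_greatest; apply inv_mono; [apply meet_l | apply meet_r].
Qed.

Lemma join_eq_l X (S T : cluster F X) : ge S T -> join O S T = S.
Proof.
intros H; apply ge_antisym; [apply join_l|].
apply join_least; trivial; apply ge_refl.
Qed.

Lemma meet_eq_l X (S T : cluster F X) : ge T S -> meet O S T = S.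
Proof.
intros H; apply ge_antisym; [apply meet_greatest; trivial; apply ge_refl|].
apply meet_l.
Qed.

Lemma Im_id X : Im O (idm X) = top O X.
Proof.
apply ge_antisym; [|apply top_greatest].
exact (dir_ge O (idm X) (top O X)).
Qed.

Lemma Ker_id X : Ker O (idm X) = bot O X.
Proof.
apply ge_antisym; [apply bot_least|].
exact (inv_ge O (idm X) (bot O X)).
Qed.

Lemma Im_comp X Y Z (f : hom X Y) (g : hom Y Z) :
  Im O (g ∘ f) = dir O g (Im O f).
Proof. apply dir_comp. Qed.

Lemma Ker_comp X Y Z (f : hom X Y) (g : hom Y Z) :
  Ker O (g ∘ f) = inv O f (Ker O g).
Proof. apply inv_comp. Qed.

Lemma Im_comp_ge X Y Z (f : hom X Y) (g : hom Y Z) : ge (Im O g) (Im O (g ∘ f)).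
Proof. rewrite Im_comp; apply dir_mono, top_greatest. Qed.

Lemma Ker_comp_ge X Y Z (f : hom X Y) (g : hom Y Z) :
  ge (Ker O (g ∘ f)) (Ker O f).
Proof. rewrite Ker_comp; apply inv_mono, bot_least. Qed.
End Orean.

(** * Noetherian forms over a category where monic epimorphisms are invertible *)

Definition mono_epi_iso (C : category) :=
  forall (X Y : C) (f : hom X Y), mono f -> epi f -> iso f.

Section MonoEpi.
Context (C : category).

Lemma mono_of_comp (X Y Z : C) (f : hom X Y) (g : hom Y Z) :
  mono (g ∘ f) -> mono f.
Proof.
intros H W u v E; apply H; now rewrite <- !comp_assoc, E.
Qed.

Lemma epi_of_comp (X Y Z : C) (f : hom X Y) (g : hom Y Z) :
  epi (g ∘ f) -> epi g.
Proof.
intros H W u v E; apply H; now rewrite !comp_assoc, E.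
Qed.

Lemma mono_id (X : C) : mono (idm X).
Proof. intros W u v; now rewrite !comp_id_l. Qed.

Lemma epi_id (X : C) : epi (idm X).
Proof. intros W u v; now rewrite !comp_id_r. Qed.
End MonoEpi.

Section Noetherian.
Context (C : category) (F : form C) (O : orean F).
Hypotheses (N : noetherian O) (balC : mono_epi_iso C).

Lemma embedding_mono X W (S : cluster F X) (m : hom W X) :
  is_embedding O S m -> mono m.
Proof.
intros [<- H] V u v E.
destruct (H V (m ∘ u)) as (g & _ & Hg); [apply Im_comp_ge|].
now rewrite <- (Hg u), <- (Hg v).
Qed.

Lemma quotient_epi X Y (S : cluster F X) (q : hom X Y) :
  is_quotient O S q -> epi q.
Proof.
intros [<- H] V u v E.
destruct (H V (u ∘ q)) as (g & _ & Hg); [apply Ker_comp_ge|].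
now rewrite <- (Hg u), <- (Hg v).
Qed.

(** In the factorization (N2) of [m] the quotient part is epi, and it is mono because [m] is. Hence
    it is invertible, and [m] is an embedding of its image up to isomorphism. *)
Lemma mono_factor X W V (m : hom W X) (u : hom V X) :
  mono m -> ge (Im O m) (Im O u) -> exists g, u = m ∘ g.
Proof.
intros Hm Hu.
destruct (noetherian_factor N m) as (I & n & e & Hn & He & E).
assert (Hi : iso e).
{ apply balC; [|now apply quotient_epi in He].
  rewrite E in Hm; now apply mono_of_comp in Hm. }
destruct Hi as (d & H1 & H2).
destruct Hn as [_ Hn]; destruct (Hn _ _ Hu) as (g & Eg & _).
exists (d ∘ g); rewrite E, comp_assoc, <- (comp_assoc n), H2, comp_id_r.
exact Eg.
Qed.

Lemma epi_factor X Y Z (e : hom X Y) (v : hom X Z) :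
  epi e -> ge (Ker O v) (Ker O e) -> exists h, v = h ∘ e.
Proof.
intros He Hv.
destruct (noetherian_factor N e) as (I & m & q & Hm & Hq & E).
assert (Hi : iso m).
{ apply balC; [now apply embedding_mono in Hm|].
  rewrite E in He; now apply epi_of_comp in He. }
destruct Hi as (d & H1 & H2).
destruct Hq as [_ Hq]; destruct (Hq _ _ Hv) as (h & Eh & _).
exists (h ∘ d); rewrite E, comp_assoc, <- (comp_assoc h), H1, comp_id_r.
exact Eh.
Qed.

(** The quotient part of [m] has the same kernel as [m] and is invertible, so this kernel lies below
    that of an identity. *)
Lemma mono_Ker X Y (m : hom X Y) : mono m -> Ker O m = bot O X.
Proof.
intros Hm.
destruct (noetherian_factor N m) as (I & n & e & Hn & He & E).
assert (Hi : iso e).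
{ apply balC; [|now apply quotient_epi in He].
  rewrite E in Hm; now apply mono_of_comp in Hm. }
destruct Hi as (d & H1 & H2), He as [<- _].
apply ge_antisym; [apply bot_least|].
rewrite <- Ker_id, <- H1; apply Ker_comp_ge.
Qed.

Lemma epi_Im X Y (e : hom X Y) : epi e -> Im O e = top O Y.
Proof.
intros He.
destruct (noetherian_factor N e) as (I & m & q & Hm & Hq & E).
assert (Hi : iso m).
{ apply balC; [now apply embedding_mono in Hm|].
  rewrite E in He; now apply epi_of_comp in He. }
destruct Hi as (d & H1 & H2), Hm as [<- _].
apply ge_antisym; [|apply top_greatest].
rewrite <- Im_id, <- H2; apply Im_comp_ge.
Qed.

Lemma Im_comp_epi X Y Z (e : hom X Y) (f : hom Y Z) :
  epi e -> Im O (f ∘ e) = Im O f.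
Proof. intros He; now rewrite Im_comp, epi_Im. Qed.

Lemma Ker_comp_mono X Y Z (f : hom X Y) (m : hom Y Z) :
  mono m -> Ker O (m ∘ f) = Ker O f.
Proof. intros He; now rewrite Ker_comp, mono_Ker. Qed.
End Noetherian.

(** * Exact meet decompositions as pairs of closure operators *)

Section FixedForms.
Context (C : category) (F : form C) (kappa : operator F F).

Lemma fixed_inclusion_fixed X (S : cluster (fixed_form kappa) X) :
  kappa X (fixed_inclusion kappa X S) = fixed_inclusion kappa X S.
Proof. destruct S as [[A p] e]; destruct e; exact p. Qed.

Lemma fixed_inclusion_inj X (S T : cluster (fixed_form kappa) X) :
  fixed_inclusion kappa X S = fixed_inclusion kappa X T -> S = T.
Proof.
intros E; apply ge_antisym.
- exact (eq_ge E).
- exact (eq_ge (eq_sym E)).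
Qed.

Hypothesis idem : idempotent_operator kappa.

Lemma fixed_restrictionK X (S : cluster F X) :
  fixed_inclusion kappa X (fixed_restriction idem X S) = kappa X S.
Proof. simpl. now destruct (kappa X S). Qed.

Context (O : orean F).
Hypothesis closure : forall X (S : cluster F X), ge (kappa X S) S.

(** A closure operator reflects clusters onto its fixed ones, so an image among the fixed clusters
    is the closure of the image in [F]. *)
Lemma fixed_Im (Ok : orean (fixed_form kappa)) X Y (f : hom X Y) :
  fixed_inclusion kappa Y (Im Ok f) = kappa Y (Im O f).
Proof.
apply ge_antisym.
- rewrite <- fixed_inclusion_fixed; apply op_ge, dir_least.
  apply ge_along_trans_r with (T := fixed_inclusion kappa X (top Ok X)).
  + exact (dir_ge Ok f (top Ok X)).
  + apply ge_trans with (T := kappa X (top O X)); [|apply closure].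
    rewrite <- fixed_restrictionK.
    exact (top_greatest Ok (fixed_restriction idem X (top O X))).
- rewrite <- fixed_restrictionK.
  refine (dir_least Ok (f := f) (S := top Ok X)
            (T := fixed_restriction idem Y (Im O f)) _).
  change (ge_along f (fixed_inclusion kappa Y (fixed_restriction idem Y (Im O f)))
            (fixed_inclusion kappa X (top Ok X))).
  rewrite fixed_restrictionK.
  apply ge_along_trans_l with (T := Im O f); [apply closure|].
  apply ge_along_trans_r with (T := top O X);
    [exact (dir_ge O f _) | apply top_greatest].
Qed.

Lemma fixed_bot (Ok : orean (fixed_form kappa)) X :
  fixed_inclusion kappa X (bot Ok X) = kappa X (bot O X).
Proof.
apply ge_antisym.
- rewrite <- fixed_inclusion_fixed; apply op_ge, bot_least.
- rewrite <- fixed_restrictionK.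
  exact (bot_least Ok (fixed_restriction idem X (bot O X))).
Qed.

(** Unlike for images, there can be a gap: the bottom fixed cluster is [kappa Y (bot O Y)], whose
    inverse image may exceed the closure of the kernel. The premise excludes this. *)
Lemma fixed_Ker (Ok : orean (fixed_form kappa)) X Y (f : hom X Y) :
  (forall S, ge_along f (kappa Y (bot O Y)) S -> ge (kappa X (Ker O f)) S) ->
  fixed_inclusion kappa X (Ker Ok f) = kappa X (Ker O f).
Proof.
intros H; apply ge_antisym.
- rewrite <- fixed_restrictionK.
  refine (inv_greatest Ok (f := f) (S := fixed_restriction idem X (Ker O f))
            (T := bot Ok Y) _).
  change (ge_along f (fixed_inclusion kappa Y (bot Ok Y))
           (fixed_inclusion kappa X (fixed_restriction idem X (Ker O f)))).
  rewrite fixed_restrictionK, fixed_bot.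
  apply op_ge, inv_ge.
- apply H; rewrite <- (fixed_bot Ok).
  exact (inv_ge Ok f (bot Ok Y)).
Qed.

(** Each operation is that of [F] followed by the reflection [r]. The rules [kle] and [gek], which
    move [r] across the relations, do all the work. *)
Lemma fixed_orean : inhabited (orean (fixed_form kappa)).
Proof.
pose (i := fixed_inclusion kappa); pose (r := fixed_restriction idem).
assert (ri : forall X S, i X (r X S) = kappa X S) by exact fixed_restrictionK.
assert (ki : forall X S, kappa X (i X S) = i X S) by exact fixed_inclusion_fixed.
assert (gi : forall X Y (f : hom X Y) (T : cluster (fixed_form kappa) Y) S,
  ge_along f (i Y T) (i X S) -> ge_along f T S) by (intros *; exact (fun h => h)).
assert (ig : forall X Y (f : hom X Y) (T : cluster (fixed_form kappa) Y) S,
  ge_along f T S -> ge_along f (i Y T) (i X S)) by (intros *; exact (fun h => h)).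
assert (kle : forall X Y (f : hom X Y) (T : cluster (fixed_form kappa) Y) S,
  ge_along f (i Y T) S -> ge_along f T (r X S)).
{ intros X Y f T S H; apply gi; rewrite ri, <- ki; now apply op_ge. }
assert (gek : forall X Y (f : hom X Y) T (S : cluster (fixed_form kappa) X),
  ge_along f T (i X S) -> ge_along f (r Y T) S).
{ intros X Y f T S H; apply gi; rewrite ri.
  exact (ge_along_trans_l (closure T) H). }
clearbody i r.
apply orean_of_exists.
- intros X; exists (r X (bot O X)); intros S; apply kle, bot_least.
- intros X; exists (r X (top O X)); intros S; apply gek, top_greatest.
- intros X S T; exists (r X (join O (i X S) (i X T))); repeat split.
  + apply gek, join_l.
  + apply gek, join_r.
  + intros U H1 H2; apply kle.
    exact (join_least O (ig _ _ _ _ _ H1) (ig _ _ _ _ _ H2)).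
- intros X S T; exists (r X (meet O (i X S) (i X T))); repeat split.
  + apply kle, meet_l.
  + apply kle, meet_r.
  + intros U H1 H2; apply gek.
    exact (meet_greatest O (ig _ _ _ _ _ H1) (ig _ _ _ _ _ H2)).
- intros X Y f S; exists (r Y (dir O f (i X S))); split.
  + apply gek, dir_ge.
  + intros Z g U H; apply kle, ge_along_dir_comp; auto.
- intros X Y f T; exists (r X (inv O f (i Y T))); split.
  + apply kle, inv_ge.
  + intros S H; apply gek, inv_greatest; auto.
Qed.
End FixedForms.

(* [ks_Ker] is the normality of the restriction of [ks] to its fixed clusters,
   stated without their orean structure; the remaining clauses of exactness
   follow. *)
Record emd_closures (C : category) (F : form C) (O : orean F)
    (ks ke : operator F F) : Prop := {
  ks_ge : forall X (S : cluster F X), ge (ks X S) S;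
  ke_ge : forall X (S : cluster F X), ge (ke X S) S;
  ks_conormal : forall X (S : cluster F X), conormal_cluster O (ks X S);
  ke_normal : forall X (S : cluster F X), normal_cluster O (ke X S);
  ks_Im : forall X Y (f : hom X Y), ks Y (Im O f) = Im O f;
  ke_Ker : forall X Y (f : hom X Y), ke X (Ker O f) = Ker O f;
  ks_Ker : forall X Y (f : hom X Y) (S : cluster F X),
    ge_along f (ks Y (bot O Y)) S -> ge (ks X (Ker O f)) S;
  ge_of_ks_ke : forall X (S U : cluster F X),
    ge (ks X S) U -> ge (ke X S) U -> ge S U
}.

(** Since a cluster is the meet of its two values, both operators are extensive. Binormality and the
    two inclusion clauses then translate images and kernels of the fixed forms into those of [F]. *)
Lemma emd_closures_of_exact (C : category) (F : form C) (O : orean F)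
    (K : meet_decomposition O) :
  exact_decomposition K -> emd_closures O (kappa_s K) (kappa_e K).
Proof.
intros ((Hs1 & Hs2) & (He1 & He2) & _ & _ & Hs & He).
assert (Hsge : forall X (S : cluster F X), ge (kappa_s K X S) S).
{ intros X S; rewrite (meet_decomp K S) at 2; apply meet_l. }
assert (Hege : forall X (S : cluster F X), ge (kappa_e K X S) S).
{ intros X S; rewrite (meet_decomp K S) at 2; apply meet_r. }
constructor; trivial.
- intros X S.
  destruct (conormal_s (fixed_restriction (kappa_s_idem K) X S)) as (W & f & E).
  exists W, f; rewrite <- (Hs _ _ f), E; apply fixed_restrictionK.
- intros X S.
  destruct (normal_e (fixed_restriction (kappa_e_idem K) X S)) as (W & f & E).
  exists W, f; rewrite <- (He _ _ f), E; apply fixed_restrictionK.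
- intros X Y f.
  rewrite <- (Hs _ _ f); apply fixed_inclusion_fixed.
- intros X Y f.
  rewrite <- (He _ _ f); apply fixed_inclusion_fixed.
- intros X Y f S H.
  (* Passing from [S] to its closure brings the comparison into the fixed form, where the kernel is
     the largest candidate. *)
  apply ge_trans with (T := kappa_s K X S); [|apply Hsge].
  rewrite <- (fixed_restrictionK (kappa_s_idem K) (Ker O f)), Hs2,
    <- (fixed_restrictionK (kappa_s_idem K) S).
  refine (inv_greatest (orean_s K) (f := f) (T := bot (orean_s K) Y)
    (S := fixed_restriction (kappa_s_idem K) X S) _).
  change (ge_along f (fixed_inclusion (kappa_s K) Y (bot (orean_s K) Y))
    (fixed_inclusion (kappa_s K) X (fixed_restriction (kappa_s_idem K) X S))).
  rewrite fixed_restrictionK, (fixed_bot (kappa_s_idem K) O).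
  rewrite <- (kappa_s_idem K (bot O Y)); now apply op_ge.
- intros X S U H1 H2; rewrite (meet_decomp K S); now apply meet_greatest.
Qed.

Program Definition operator_comp (C : category) (F G H : form C)
    (sigma : operator G H) (tau : operator F G) : operator F H :=
  {| op := fun X S => sigma X (tau X S) |}.
Next Obligation. intros; now apply op_ge, op_ge. Qed.

Section Exact.
Context (C : category) (F : form C) (O : orean F) (ks ke : operator F F).
Hypothesis H : emd_closures O ks ke.

Lemma ks_idem : idempotent_operator ks.
Proof. intros X S; destruct (ks_conormal H S) as (W & f & <-); apply (ks_Im H). Qed.

Lemma ke_idem : idempotent_operator ke.
Proof. intros X S; destruct (ke_normal H S) as (W & f & <-); apply (ke_Ker H). Qed.

Lemma ke_bot X : ke X (bot O X) = bot O X.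
Proof. rewrite <- Ker_id; apply (ke_Ker H). Qed.

Lemma emd_closures_decompose X (S : cluster F X) : S = meet O (ks X S) (ke X S).
Proof.
apply ge_antisym.
- apply (ge_of_ks_ke H); [apply meet_l | apply meet_r].
- apply meet_greatest; [apply (ks_ge H) | apply (ke_ge H)].
Qed.

(** The converse passage: the fixed forms get their orean structures from [fixed_orean], and the
    required operators between them are an inclusion into [F] followed by a restriction. *)
Lemma exact_of_emd_closures : exists K : meet_decomposition O, exact_decomposition K.
Proof.
destruct (fixed_orean ks_idem O (ks_ge H)) as [Os].
destruct (fixed_orean ke_idem O (ke_ge H)) as [Oe].
assert (ImS : forall X Y (f : hom X Y), fixed_inclusion ks Y (Im Os f) = Im O f).
{ intros X Y f; rewrite (fixed_Im ks_idem O (ks_ge H)); apply (ks_Im H). }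
assert (KerS : forall X Y (f : hom X Y),
  fixed_inclusion ks X (Ker Os f) = ks X (Ker O f)).
{ intros X Y f; apply (fixed_Ker ks_idem), (ks_Ker H). }
assert (ImE : forall X Y (f : hom X Y),
  fixed_inclusion ke Y (Im Oe f) = ke Y (Im O f)).
{ intros X Y f; exact (fixed_Im ke_idem O (ke_ge H) Oe f). }
assert (KerE : forall X Y (f : hom X Y), fixed_inclusion ke X (Ker Oe f) = Ker O f).
{ intros X Y f; rewrite (fixed_Ker (O := O) ke_idem); [apply (ke_Ker H)|].
  (* The gap in [fixed_Ker] is absent here, because [ke] fixes the bottom cluster, the kernel of an
     identity. *)
  intros S HS; rewrite (ke_Ker H); apply inv_greatest; now rewrite ke_bot in HS. }
assert (Cs : conormal_form Os).
{ intros X S.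
  destruct (ks_conormal H (fixed_inclusion ks X S)) as (W & f & E).
  exists W, f; apply fixed_inclusion_inj.
  now rewrite ImS, E, fixed_inclusion_fixed. }
assert (Ne : normal_form Oe).
{ intros X S.
  destruct (ke_normal H (fixed_inclusion ke X S)) as (W & f & E).
  exists W, f; apply fixed_inclusion_inj.
  now rewrite KerE, E, fixed_inclusion_fixed. }
exists {| kappa_s_idem := ks_idem; kappa_e_idem := ke_idem; conormal_s := Cs;
  normal_e := Ne; meet_decomp := emd_closures_decompose |}.
unfold exact_decomposition;
  cbn [kappa_s kappa_e orean_s orean_e kappa_s_idem kappa_e_idem].
repeat split.
- intros X Y f; apply fixed_inclusion_inj.
  now rewrite fixed_restrictionK, ImS, (ks_Im H).
- intros X Y f; apply fixed_inclusion_inj.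
  now rewrite fixed_restrictionK, KerS.
- intros X Y f; apply fixed_inclusion_inj.
  now rewrite fixed_restrictionK, ImE.
- intros X Y f; apply fixed_inclusion_inj.
  now rewrite fixed_restrictionK, KerE, (ke_Ker H).
- exists (operator_comp (fixed_restriction ke_idem) (fixed_inclusion ks)).
  intros X Y f; apply fixed_inclusion_inj.
  cbn [op operator_comp].
  now rewrite fixed_restrictionK, ImE, ImS.
- exists (operator_comp (fixed_restriction ks_idem) (fixed_inclusion ke)).
  intros X Y f; apply fixed_inclusion_inj.
  cbn [op operator_comp].
  now rewrite fixed_restrictionK, KerS, KerE.
- intros X Y f; apply ImS.
- intros X Y f; apply KerE.
Qed.
End Exact.

(** * Initial objects and pushouts as finite colimits *)

Definition is_initial (C : category) (X : C) := forall W, exists! f : hom X W, True.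

#[local] Obligation Tactic := idtac.

Program Definition empty_cat : category := {|
  ob := Empty_set;
  hom := fun i j => Empty_set;
  idm := fun i => match i with end;
  comp := fun i j k g f => match i with end
|}.
Next Obligation. intros []. Qed.
Next Obligation. intros []. Qed.
Next Obligation. intros []. Qed.

Program Definition empty_diagram (C : category) : functor empty_cat C := {|
  fob := fun i => match i with end;
  fmap := fun i j f => match i with end
|}.
Next Obligation. intros C []. Qed.
Next Obligation. intros C []. Qed.

Lemma empty_cat_finite : finite_category empty_cat.
Proof. split; [exists nil; intros [] | intros []]. Qed.

Lemma is_colimit_empty (C : category) (D : functor empty_cat C) (L : C)
    (leg : forall j, hom (D j) L) : is_colimit leg <-> is_initial L.
Proof.
split.
- intros [_ H] W.
  destruct (H W (fun j => match j with end)) as (h & _ & Hu); [intros []|].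
  exists h; split; trivial; intros h' _; apply Hu; intros [].
- intros H; split; [intros []|].
  intros W leg' _; destruct (H W) as (h & _ & Hu).
  exists h; split; [intros [] | auto].
Qed.

(** [None] is the apex of the span and the two [Some] are its feet. A boolean order makes each hom
    type decidable with at most one element, hence finite. *)
Definition span_le (i j : option bool) : bool :=
  match i, j with
  | None, _ => true
  | Some a, Some b => Bool.eqb a b
  | Some _, None => false
  end.

Program Definition span_cat : category := {|
  ob := option bool;
  hom := fun i j => span_le i j = true
|}.
Next Obligation. intros [[|]|]; reflexivity. Qed.
Next Obligation. intros [[|]|] [[|]|] [[|]|]; simpl; congruence. Qed.
Next Obligation. intros; apply proof_irrelevance. Qed.
Next Obligation. intros; apply proof_irrelevance. Qed.
Next Obligation. intros; apply proof_irrelevance. Qed.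

Definition span_left : @hom span_cat None (Some true) := eq_refl.
Definition span_right : @hom span_cat None (Some false) := eq_refl.

Lemma span_cat_finite : finite_category span_cat.
Proof.
split.
- exists (None :: Some true :: Some false :: nil); intros [[|]|]; simpl; auto.
- intros i j; destruct (Bool.bool_dec (span_le i j) true) as [h|h].
  + exists (h :: nil); intros h'; left; exact (proof_irrelevance (_ = true) _ _).
  + exists nil; intros h'; exact (h h').
Qed.

Section Span.
Context (C : category).

Definition span_ob (X Y Z : C) (i : span_cat) : C :=
  match i with None => Z | Some true => X | Some false => Y end.

Definition span_hom (X Y Z : C) (f : hom Z X) (g : hom Z Y) (i j : span_cat) :
    hom i j -> hom (span_ob X Y Z i) (span_ob X Y Z j) :=
  match i, j return @hom span_cat i j -> hom (span_ob X Y Z i) (span_ob X Y Z j) with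
  | None, None => fun _ => idm Z
  | None, Some true => fun _ => f
  | None, Some false => fun _ => g
  | Some true, Some true => fun _ => idm X
  | Some false, Some false => fun _ => idm Y
  | _, _ => fun h => False_rect _ (Bool.diff_false_true h)
  end.

Program Definition span_diagram (X Y Z : C) (f : hom Z X) (g : hom Z Y) :
    functor span_cat C := {|
  fob := span_ob X Y Z;
  fmap := span_hom f g
|}.
Next Obligation. intros X Y Z f g [[|]|]; reflexivity. Qed.
Next Obligation.
intros X Y Z f g [[|]|] [[|]|] [[|]|] u v; try discriminate u; try discriminate v;
  simpl; now rewrite ?comp_id_l, ?comp_id_r.
Qed.

Definition span_leg (D : functor span_cat C) (P : C) (p : hom (D (Some true)) P)
    (q : hom (D (Some false)) P) (i : span_cat) : hom (D i) P :=
  match i with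
  | None => p ∘ fmap D span_left
  | Some true => p
  | Some false => q
  end.

Lemma span_id (D : functor span_cat C) (i : span_cat) (a : hom i i) :
  fmap D a = idm (D i).
Proof. rewrite <- fmap_id; f_equal; exact (proof_irrelevance (_ = true) _ _). Qed.

Lemma span_leg_cocone (D : functor span_cat C) (P : C)
    (p : hom (D (Some true)) P) (q : hom (D (Some false)) P) :
  p ∘ fmap D span_left = q ∘ fmap D span_right ->
  forall i j (a : hom i j), span_leg p q j ∘ fmap D a = span_leg p q i.
Proof.
intros E [[|]|] [[|]|] a; try discriminate a; simpl;
  rewrite ?span_id, ?comp_id_r; trivial.
- now rewrite (proof_irrelevance (_ = true) a span_left).
- now rewrite (proof_irrelevance (_ = true) a span_right).
Qed.

(** Stated for any functor on [span_cat], so that it also applies to the composite of [T] with a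
    span diagram. *)
Lemma is_pushout_of_colimit (D : functor span_cat C) (P : C)
    (leg : forall i, hom (D i) P) :
  is_colimit leg ->
  is_pushout (fmap D span_left) (fmap D span_right) (leg (Some true)) (leg (Some false)).
Proof.
intros [Hl Hu]; split; [now rewrite !Hl|].
intros W u v E.
destruct (Hu W (span_leg u v) (span_leg_cocone E)) as (h & Hh & Hh').
exists h; split; [split; [apply (Hh (Some true)) | apply (Hh (Some false))]|].
intros h' [E1 E2]; apply Hh'; intros [[|]|]; trivial.
simpl; rewrite <- E1, <- (Hl _ _ span_left); apply comp_assoc.
Qed.

Lemma is_colimit_of_pushout (D : functor span_cat C) (P : C)
    (p : hom (D (Some true)) P) (q : hom (D (Some false)) P) :
  is_pushout (fmap D span_left) (fmap D span_right) p q ->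
  is_colimit (span_leg p q).
Proof.
intros [E Hu]; split; [now apply span_leg_cocone|].
intros W leg Hl.
destruct (Hu W (leg (Some true)) (leg (Some false))) as (h & [E1 E2] & Hh);
  [now rewrite !Hl|].
exists h; split.
- intros [[|]|]; trivial; simpl; now rewrite comp_assoc, E1, Hl.
- intros h' Hh'; apply Hh; split; [apply (Hh' (Some true)) | apply (Hh' (Some false))].
Qed.
End Span.

Section FiniteColimits.
Context (C C' : category) (T : functor C C').
Hypotheses (colimC : has_finite_colimits C) (T_colim : preserves_finite_colimits T).

Lemma initial_of_finite_colimits : exists Z : C, is_initial Z /\ is_initial (T Z).
Proof.
destruct (colimC (empty_diagram C) empty_cat_finite) as (Z & leg & HZ).
exists Z; split.
- now apply is_colimit_empty in HZ.
- apply (T_colim empty_cat_finite) in HZ; now apply is_colimit_empty in HZ.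
Qed.

Lemma pushout_of_finite_colimits (X Y Z : C) (f : hom Z X) (g : hom Z Y) :
  exists P (p : hom X P) (q : hom Y P), is_pushout f g p q.
Proof.
destruct (colimC (span_diagram f g) span_cat_finite) as (P & leg & HP).
exists P, (leg (Some true)), (leg (Some false)); exact (is_pushout_of_colimit HP).
Qed.

Lemma preserves_pushouts (P X Y Z : C) (f : hom Z X) (g : hom Z Y)
    (p : hom X P) (q : hom Y P) :
  is_pushout f g p q -> is_pushout (fmap T f) (fmap T g) (fmap T p) (fmap T q).
Proof.
intros H; apply (is_colimit_of_pushout (D := span_diagram f g)) in H.
apply (T_colim span_cat_finite) in H; exact (is_pushout_of_colimit H).
Qed.
End FiniteColimits.

(** * Pulling a form back along a functor *)

Section PulledBackForm.
Context (C C' : category) (T : functor C C') (F' : form C').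
Variable P : forall X, cluster F' (T X) -> Prop.

(** A morphism is one of [C] with a proof of a relation. The projection to [C] is thus faithful by
    proof irrelevance, and amnestic by antisymmetry of the cluster order in [F']. *)
Program Definition pb_cat : category := {|
  ob := {X : C & {A : cluster F' (T X) | P A}};
  hom := fun a b => {f : hom (projT1 a) (projT1 b) |
    ge_along (fmap T f) (proj1_sig (projT2 b)) (proj1_sig (projT2 a))};
  idm := fun a => idm (projT1 a);
  comp := fun a b c g f => proj1_sig g ∘ proj1_sig f
|}.
Next Obligation. intros a; simpl; rewrite fmap_id; apply ge_refl. Qed.
Next Obligation.
intros a b c [g Hg] [f Hf]; simpl; rewrite fmap_comp.
exact (ge_along_comp Hg Hf).
Qed.
Next Obligation. intros; apply subset_eq_compat, comp_assoc. Qed.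
Next Obligation. intros X Y [f Hf]; apply subset_eq_compat, comp_id_l. Qed.
Next Obligation. intros X Y [f Hf]; apply subset_eq_compat, comp_id_r. Qed.

Program Definition pb_fun : functor pb_cat C := {|
  fob := fun a => projT1 a;
  fmap := fun a b f => proj1_sig f
|}.
Next Obligation. reflexivity. Qed.
Next Obligation. reflexivity. Qed.

Program Definition pb_form : form C := {| form_fun := pb_fun |}.
Next Obligation.
intros a b [f Hf] [g Hg]; simpl; apply subset_eq_compat.
Qed.
Next Obligation.
intros [X [A pA]] [Y [B pB]] [i Hi] [[j Hj] [Hji _]] Hid; simpl in *.
apply (f_equal (@proj1_sig _ _)) in Hji; simpl in Hji.
destruct Hid; rewrite comp_id_r in Hji; subst j.
pose proof Hi as Hi'; pose proof Hj as Hj'; rewrite fmap_id in Hi', Hj'.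
pose proof (ge_antisym Hi' Hj') as E; subst B; clear Hi' Hj'.
rewrite (proof_irrelevance _ pB pA) in *.
pose (a := existT (fun X => {A : cluster F' (T X) | P A}) X (exist _ A pA) : pb_cat).
rewrite (proof_irrelevance _ Hi (proj2_sig (idm a))).
exact (@is_identity_idm pb_cat a).
Qed.

Definition pb_val X (S : cluster pb_form X) : cluster F' (T X) :=
  match proj2_sig S in _ = Y return cluster F' (T Y) with
  | eq_refl => proj1_sig (projT2 (proj1_sig S))
  end.

Definition pb_mk X (A : cluster F' (T X)) (p : P A) : cluster pb_form X :=
  exist (fun a : pb_cat => pb_fun a = X) (existT _ X (exist _ A p)) eq_refl.

Lemma pb_valP X (S : cluster pb_form X) : P (pb_val S).
Proof. destruct S as [[Y [A p]] e]; destruct e; exact p. Qed.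

Lemma pb_ge_along X Y (f : hom X Y) (U : cluster pb_form Y) (S : cluster pb_form X) :
  ge_along f U S <-> ge_along (fmap T f) (pb_val U) (pb_val S).
Proof.
destruct U as [[Y' [B pB]] eY], S as [[X' [A pA]] eX]; simpl in *; subst Y' X'.
unfold pb_val; simpl; split.
- intros [[g Hg] E]; simpl in *; now subst g.
- intros H; now exists (exist _ f H).
Qed.

Lemma pb_ge X (U S : cluster pb_form X) : ge U S <-> ge (pb_val U) (pb_val S).
Proof. unfold ge at 1; now rewrite pb_ge_along, fmap_id. Qed.

Lemma pb_val_inj X (U S : cluster pb_form X) : pb_val U = pb_val S -> U = S.
Proof. intros E; apply ge_antisym; apply pb_ge; rewrite E; apply ge_refl. Qed.

Program Definition pb_operator (kappa : operator F' F')
    (h : forall X (A : cluster F' (T X)), P A -> P (kappa (T X) A)) :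
  operator pb_form pb_form :=
  {| op := fun X S => pb_mk (h X _ (pb_valP S)) |}.
Next Obligation.
intros kappa h X Y f S U H; apply pb_ge_along, op_ge.
now apply pb_ge_along.
Qed.
End PulledBackForm.

(** * Transfer of the emd-noetherian form *)

Section Transfer.
Context (C C' : category) (T : functor C C') (F : form C') (O : orean F)
  (ks ke : operator F F).
Hypotheses (N : noetherian O) (H : emd_closures O ks ke).
Hypotheses (balC : mono_epi_iso C) (balC' : mono_epi_iso C').
Hypothesis factorC : forall (X Y : C) (f : hom X Y),
  exists I (e : hom X I) (m : hom I Y), epi e /\ mono m /\ f = m ∘ e.
Hypotheses (T_faithful : faithful T) (T_mono : preserves_monos T)
  (T_pb : preserves_pullbacks_of_epis T).
Hypothesis pushC : forall (X Y Z : C) (f : hom Z X) (g : hom Z Y),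
  exists P (p : hom X P) (q : hom Y P), is_pushout f g p q.
Hypothesis T_push : forall (P X Y Z : C) (f : hom Z X) (g : hom Z Y)
    (p : hom X P) (q : hom Y P),
  is_pushout f g p q -> is_pushout (fmap T f) (fmap T g) (fmap T p) (fmap T q).
Hypothesis pbC : has_pullbacks C.
Context (zero one : C).
Hypotheses (zeroC : is_initial zero) (zeroC' : is_initial (T zero))
  (oneC : is_terminal one) (oneC' : is_terminal (T one)).

(** * Images and kernels of morphisms coming from C *)

Notation TIm k := (Im O (fmap T k)).
Notation TKer g := (Ker O (fmap T g)).

(** A morphism is epi exactly when two identities form its pushout along itself, and [T] preserves
    pushouts. *)
Lemma T_epi (X Y : C) (e : hom X Y) : epi e -> epi (fmap T e).
Proof.
intros He.
assert (Hp : is_pushout e e (idm Y) (idm Y)).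
{ split; trivial; intros W u v E; exists u; split.
  - rewrite comp_id_r; split; trivial; now apply He.
  - intros h [E1 _]; now rewrite <- E1, comp_id_r. }
apply T_push in Hp; rewrite fmap_id in Hp; destruct Hp as [_ Hp].
intros W u v E; destruct (Hp W u v E) as (h & [<- <-] & _); reflexivity.
Qed.

Lemma T_reflects_mono (X Y : C) (f : hom X Y) : mono (fmap T f) -> mono f.
Proof.
intros Hf W u v E; apply T_faithful, Hf; now rewrite <- !fmap_comp, E.
Qed.

Lemma T_reflects_epi (X Y : C) (f : hom X Y) : epi (fmap T f) -> epi f.
Proof.
intros Hf W u v E; apply T_faithful, Hf; now rewrite <- !fmap_comp, E.
Qed.

Lemma TIm_epi (X Y Z : C) (e : hom X Y) (f : hom Y Z) :
  epi e -> TIm (f ∘ e) = TIm f.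
Proof.
intros He; rewrite fmap_comp; apply (Im_comp_epi N balC'); now apply T_epi.
Qed.

Lemma TKer_mono (X Y Z : C) (f : hom X Y) (m : hom Y Z) :
  mono m -> TKer (m ∘ f) = TKer f.
Proof.
intros Hm; rewrite fmap_comp; apply (Ker_comp_mono N balC'); now apply T_mono.
Qed.

Lemma TIm_comp_ge (X Y Z : C) (f : hom X Y) (g : hom Y Z) :
  ge (TIm g) (TIm (g ∘ f)).
Proof. rewrite fmap_comp; apply Im_comp_ge. Qed.

Lemma TKer_comp_ge (X Y Z : C) (f : hom X Y) (g : hom Y Z) :
  ge (TKer (g ∘ f)) (TKer f).
Proof. rewrite fmap_comp; apply Ker_comp_ge. Qed.

Lemma dir_TIm (X Y Z : C) (f : hom X Y) (g : hom Y Z) :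
  dir O (fmap T g) (TIm f) = TIm (g ∘ f).
Proof. now rewrite fmap_comp, Im_comp. Qed.

Lemma inv_TKer (X Y Z : C) (f : hom X Y) (g : hom Y Z) :
  inv O (fmap T f) (TKer g) = TKer (g ∘ f).
Proof. now rewrite fmap_comp, Ker_comp. Qed.

(** * Reflection of order; joins, meets and inverse images computed in C *)

Lemma TIm_as_mono (X W : C) (k : hom W X) :
  exists V (l : hom V X), mono l /\ TIm k = TIm l.
Proof.
destruct (factorC k) as (V & e & l & He & Hl & ->).
exists V, l; split; trivial; now apply TIm_epi.
Qed.

Lemma TKer_as_epi (X Y : C) (g : hom X Y) :
  exists V (e : hom X V), epi e /\ TKer g = TKer e.
Proof.
destruct (factorC g) as (V & e & m & He & Hm & ->).
exists V, e; split; trivial; now apply TKer_mono.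
Qed.

(** Here [c] is the copairing of [k] and [l] on their coproduct, the pushout over [zero]. As [T]
    preserves it, the universal property holds against all conormal clusters [U] of [F], not only
    those from [C]. *)
Lemma TIm_join (X V W : C) (k : hom V X) (l : hom W X) :
  exists S (c : hom S X) a b, k = c ∘ a /\ l = c ∘ b /\
    forall U, conormal_cluster O U -> ge U (TIm k) -> ge U (TIm l) -> ge U (TIm c).
Proof.
destruct (zeroC V) as (zV & _ & _), (zeroC W) as (zW & _ & _).
destruct (pushC zV zW) as (S & a & b & HS).
destruct (proj2 HS X k l) as (c & [Ea Eb] & _).
{ destruct (zeroC X) as (z & _ & Hz); now rewrite <- (Hz (k ∘ zV)), <- (Hz (l ∘ zW)). }
exists S, c, a, b; repeat split; auto.
intros U (U0 & u & <-) Hk Hl.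
destruct (noetherian_factor N u) as (U1 & m & e & Hm & _ & _).
pose proof (embedding_mono Hm) as Hmm; destruct Hm as [Em _].
rewrite <- Em in Hk, Hl |- *.
destruct (mono_factor N balC' Hmm Hk) as (k' & Ek).
destruct (mono_factor N balC' Hmm Hl) as (l' & El).
apply T_push in HS.
destruct (proj2 HS _ k' l') as (c' & [Ea' Eb'] & _).
{ destruct (zeroC' U1) as (z & _ & Hz).
  now rewrite <- (Hz (k' ∘ fmap T zV)), <- (Hz (l' ∘ fmap T zW)). }
(* Both morphisms restrict to [T k] and [T l] on the coproduct [T S], hence agree. *)
replace (fmap T c) with (m ∘ c'); [apply Im_comp_ge|].
destruct (proj2 HS _ (fmap T k) (fmap T l)) as (h & _ & Hh).
{ rewrite Ek, El, <- !comp_assoc, <- Ea', <- Eb', <- !comp_assoc.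
  now rewrite (proj1 HS). }
rewrite <- (Hh (fmap T c)), <- (Hh (m ∘ c')); trivial; split.
- now rewrite Ek, <- Ea', comp_assoc.
- now rewrite El, <- Eb', comp_assoc.
- now rewrite <- fmap_comp, Ea.
- now rewrite <- fmap_comp, Eb.
Qed.

(** [T] reflects the order of subobjects. If [n] is the mono part of the copairing of [k] and [l],
    then [l] is [n] after the mono [e ∘ b]. In [C'] the image of [n] lies below that of [l], which
    makes [T (e ∘ b)] split epi. So [e ∘ b] is invertible, and [k] factors through [l]. *)
Lemma TIm_factor (X V W : C) (k : hom V X) (l : hom W X) :
  mono l -> ge (TIm l) (TIm k) -> exists u, k = l ∘ u.
Proof.
intros Hl Hk.
destruct (TIm_join k l) as (S & c & a & b & -> & El & Hc).
destruct (factorC c) as (J & e & n & He & Hn & ->).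
assert (Hi : iso (e ∘ b)).
{ apply balC.
  - apply mono_of_comp with (g := n); now rewrite comp_assoc, <- El.
  - assert (Hcl : ge (TIm l) (TIm n)).
    { rewrite <- (TIm_epi n He); apply Hc; trivial; [|apply ge_refl].
      now exists (T W), (fmap T l). }
    apply (mono_factor N balC') in Hcl; [|now apply T_mono].
    destruct Hcl as (w & Ew).
    apply T_reflects_epi, epi_of_comp with (f := w).
    replace (fmap T (e ∘ b) ∘ w) with (idm (T J)); [apply epi_id|].
    apply (T_mono Hn).
    now rewrite comp_assoc, <- fmap_comp, comp_assoc, <- El, <- Ew, comp_id_r. }
destruct Hi as (d & _ & Hd).
exists (d ∘ (e ∘ a)).
replace (n ∘ e ∘ a) with (n ∘ (e ∘ b ∘ d) ∘ (e ∘ a))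
  by now rewrite Hd, comp_id_r, comp_assoc.
now rewrite El, !comp_assoc.
Qed.

(** [T] reflects the order of quotients. The pushout [q] of [g] along [h] is epi. As [T h] factors
    through [T g], the morphism [T q] is split mono, so [q] is invertible. *)
Lemma TKer_factor (X V W : C) (g : hom X V) (h : hom X W) :
  epi g -> ge (TKer h) (TKer g) -> exists u, h = u ∘ g.
Proof.
intros Hg Hh.
destruct (pushC g h) as (P & p & q & HP).
pose proof (T_push HP) as HP'.
assert (Hi : iso q).
{ apply balC.
  - apply (epi_factor N balC') in Hh; [|now apply T_epi].
    destruct Hh as (w & Ew).
    destruct (proj2 HP' _ w (idm _)) as (r & [_ Er] & _);
      [now rewrite comp_id_l|].
    apply T_reflects_mono, mono_of_comp with (g := r).
    rewrite Er; apply mono_id.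
  - intros U u v E.
    destruct (proj2 HP U (u ∘ p) (u ∘ q)) as (r & _ & Hr).
    { now rewrite <- !comp_assoc, (proj1 HP). }
    rewrite <- (Hr u), <- (Hr v); auto; split; auto.
    apply Hg; now rewrite <- !comp_assoc, (proj1 HP), !comp_assoc, E. }
destruct Hi as (d & Hd & _).
exists (d ∘ p).
now rewrite <- comp_assoc, (proj1 HP), comp_assoc, Hd, comp_id_l.
Qed.

(** The diagonal of the pushout of the epi parts; as [T] preserves it, it serves all normal clusters
    of [F]. *)
Lemma TKer_join (X V W : C) (g : hom X V) (h : hom X W) :
  exists S (r : hom X S), ge (TKer r) (TKer g) /\ ge (TKer r) (TKer h) /\
    forall U, normal_cluster O U -> ge U (TKer g) -> ge U (TKer h) -> ge U (TKer r).
Proof.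
destruct (TKer_as_epi g) as (V1 & g1 & Hg1 & ->).
destruct (TKer_as_epi h) as (W1 & h1 & Hh1 & ->).
destruct (pushC g1 h1) as (P & p & q & HP).
exists P, (p ∘ g1); split; [|split].
- apply TKer_comp_ge.
- rewrite (proj1 HP); apply TKer_comp_ge.
- intros U (U0 & u & <-) Hg Hh.
  apply (epi_factor N balC') in Hg; [|now apply T_epi].
  apply (epi_factor N balC') in Hh; [|now apply T_epi].
  destruct Hg as (g' & Eg), Hh as (h' & Eh).
  destruct (proj2 (T_push HP) _ g' h') as (r & [Er _] & _);
    [now rewrite <- Eg, <- Eh|].
  rewrite Eg, <- Er, <- comp_assoc, <- fmap_comp; apply Ker_comp_ge.
Qed.

(** The pullback is taken in [C] and need not be preserved by [T], so [TIm l] is compared only with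
    images of morphisms of [C]. *)
Lemma TIm_inv (X Y W : C) (f : hom X Y) (k : hom W Y) :
  exists V (l : hom V X), ge_along (fmap T f) (TIm k) (TIm l) /\
    forall U (u : hom U X), ge_along (fmap T f) (TIm k) (TIm u) -> ge (TIm l) (TIm u).
Proof.
destruct (TIm_as_mono k) as (W1 & k1 & Hk1 & ->).
destruct (pbC k1 f) as (V & p & l & E & Hl).
exists V, l; split.
- apply (ge_along_of_dir (O := O)); rewrite dir_TIm, <- E; apply TIm_comp_ge.
- intros U u Hu; apply (dir_least O) in Hu; rewrite dir_TIm in Hu.
  apply TIm_factor in Hu; trivial; destruct Hu as (v & Ev).
  destruct (Hl U v u (eq_sym Ev)) as (w & [_ <-] & _).
  apply TIm_comp_ge.
Qed.

Lemma TIm_meet (X V W : C) (k : hom V X) (l : hom W X) :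
  exists S (c : hom S X), ge (TIm k) (TIm c) /\ ge (TIm l) (TIm c) /\
    forall U (u : hom U X), ge (TIm k) (TIm u) -> ge (TIm l) (TIm u) ->
      ge (TIm c) (TIm u).
Proof.
destruct (TIm_as_mono k) as (V1 & k1 & Hk1 & ->).
destruct (TIm_as_mono l) as (W1 & l1 & Hl1 & ->).
destruct (pbC k1 l1) as (S & p & q & E & HS).
exists S, (k1 ∘ p); split; [|split].
- apply TIm_comp_ge.
- rewrite E; apply TIm_comp_ge.
- intros U u Hk Hl.
  apply TIm_factor in Hk, Hl; trivial.
  destruct Hk as (a & ->), Hl as (b & Eb).
  destruct (HS U a b Eb) as (w & [<- _] & _).
  rewrite comp_assoc; apply TIm_comp_ge.
Qed.

(** Here [r] is the pairing of [g] and [h] into their product, the pullback over [one]. *)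
Lemma TKer_meet (X V W : C) (g : hom X V) (h : hom X W) :
  exists S (r : hom X S), ge (TKer g) (TKer r) /\ ge (TKer h) (TKer r) /\
    forall U (u : hom X U), ge (TKer g) (TKer u) -> ge (TKer h) (TKer u) ->
      ge (TKer r) (TKer u).
Proof.
destruct (oneC V) as (tV & _ & _), (oneC W) as (tW & _ & _).
destruct (pbC tV tW) as (S & p & q & E & HS).
assert (one_eq : forall Z (a b : hom Z one), a = b).
{ intros Z a b; destruct (oneC Z) as (t & _ & Ht).
  now rewrite <- (Ht a), <- (Ht b). }
destruct (HS X g h) as (r & [Eg Eh] & Hr); [apply one_eq|].
exists S, r; split; [|split].
- rewrite <- Eg; apply TKer_comp_ge.
- rewrite <- Eh; apply TKer_comp_ge.
- intros U u Hg Hh.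
  (* Reflection of order needs an epi, so [u] gives way to its epi part, through which [g], [h] and
     hence their pairing factor. *)
  destruct (TKer_as_epi u) as (U1 & u1 & Hu1 & Eu); rewrite Eu in *.
  apply TKer_factor in Hg, Hh; trivial.
  destruct Hg as (a & Ea), Hh as (b & Eb).
  destruct (HS U1 a b) as (w & [Ew1 Ew2] & _); [apply one_eq|].
  rewrite (Hr (w ∘ u1)); [apply TKer_comp_ge|].
  now rewrite !comp_assoc, Ew1, Ew2.
Qed.

(** * Stability properties of the clusters that descend to C *)

Definition descends X (A : cluster F (T X)) :=
  (exists W (k : hom W X), ks (T X) A = TIm k) /\
  (exists Y (g : hom X Y), ke (T X) A = TKer g).

(** The direct image of [ks A] is again an image, hence already closed. *)
Lemma ks_dir (X Y W : C) (f : hom X Y) (k : hom W X) (A : cluster F (T X)) :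
  ks (T X) A = TIm k -> ks (T Y) (dir O (fmap T f) A) = TIm (f ∘ k).
Proof.
intros E; apply ge_antisym.
- rewrite <- dir_TIm; apply dir_least; rewrite <- E; apply op_ge, dir_ge.
- rewrite <- (ks_Im H (fmap T (f ∘ k))), <- dir_TIm, <- E.
  apply op_ge, dir_mono, (ks_ge H).
Qed.

(** With [ke A] the kernel of an epi [T e], the witness [q] is the pushout of [e] along [f]. If
    [Ker b] is the closure of the direct image, then [b ∘ T f] kills [ke A], so [b] factors through
    [T q]. *)
Lemma ke_dir (X Y V : C) (f : hom X Y) (g : hom X V) (A : cluster F (T X)) :
  ke (T X) A = TKer g ->
  exists W (q : hom Y W), ke (T Y) (dir O (fmap T f) A) = TKer q.
Proof.
destruct (TKer_as_epi g) as (V1 & e & He & ->); intros E.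
destruct (pushC e f) as (W & p & q & HW).
exists W, q; apply ge_antisym.
- destruct (ke_normal H (dir O (fmap T f) A)) as (B & b & Eb); rewrite <- Eb.
  assert (Hb : ge_along (fmap T f) (Ker O b) (TKer e)).
  { rewrite Eb, <- E; apply op_ge, dir_ge. }
  apply (inv_greatest O) in Hb; rewrite <- Ker_comp in Hb.
  apply (epi_factor N balC') in Hb; [|now apply T_epi]; destruct Hb as (c & Ec).
  destruct (proj2 (T_push HW) _ c b (eq_sym Ec)) as (h & [_ <-] & _).
  apply Ker_comp_ge.
- rewrite <- (ke_Ker H (fmap T q)); apply op_ge, dir_least.
  apply ge_along_trans_r with (T := TKer e); [|rewrite <- E; apply (ke_ge H)].
  apply (ge_along_of_inv (O := O)); rewrite inv_TKer, <- (proj1 HW).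
  apply TKer_comp_ge.
Qed.

Lemma descends_dir (X Y : C) (f : hom X Y) (A : cluster F (T X)) :
  descends A -> descends (dir O (fmap T f) A).
Proof.
intros [(W & k & Ek) (V & g & Eg)]; split.
- exists W, (f ∘ k); now apply ks_dir.
- exact (ke_dir f Eg).
Qed.

(** The closure is the image of some [v], and the morphism from the initial object [T zero] factors
    through [v]. *)
Lemma ks_bot (X : C) (z : hom zero X) : ks (T X) (bot O (T X)) = TIm z.
Proof.
apply ge_antisym.
- destruct (ks_conormal H (bot O (T X))) as (V & v & <-).
  destruct (zeroC' V) as (zV & _ & _), (zeroC' (T X)) as (zX & _ & Hz).
  rewrite <- (Hz (fmap T z)), (Hz (v ∘ zV)); trivial; apply Im_comp_ge.
- rewrite <- (ks_Im H (fmap T z)); apply op_ge, bot_least.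
Qed.

(* The preimage of the least subobject along [h] is its preimage along the epi
   part of [h], hence a pullback which [T] preserves. *)
Lemma ks_TKer (X Y : C) (h : hom X Y) :
  exists W (l : hom W X), ks (T X) (TKer h) = TIm l.
Proof.
destruct (factorC h) as (J & e & m & He & Hm & ->).
destruct (zeroC J) as (z & _ & _).
destruct (factorC z) as (K & ze & zm & Hze & Hzm & ->).
destruct (pbC e zm) as (W & l & w & HW).
exists W, l.
assert (Hbot : ks (T Y) (bot O (T Y)) = TIm (m ∘ zm)).
{ rewrite (ks_bot (m ∘ zm ∘ ze)); now apply TIm_epi. }
apply ge_antisym.
- apply (ks_Ker H); rewrite Hbot.
  apply (ge_along_of_dir (O := O)).
  rewrite dir_TIm, <- comp_assoc, (proj1 HW), comp_assoc; apply TIm_comp_ge.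
(* The closure is the image of some [u]. Cancelling [T m] turns the factorization of [T (m ∘ e) ∘ u]
   into a cone over the preserved pullback. *)
- assert (Hk : ge_along (fmap T (m ∘ e)) (TIm (m ∘ zm)) (ks (T X) (TKer (m ∘ e)))).
  { rewrite <- Hbot; apply op_ge, inv_ge. }
  destruct (ks_conormal H (TKer (m ∘ e))) as (U & u & Eu); rewrite <- Eu in *.
  apply (dir_least O) in Hk; rewrite <- Im_comp in Hk.
  apply (mono_factor N balC') in Hk.
  2:{ rewrite fmap_comp; intros V a b E; apply (T_mono Hzm), (T_mono Hm).
      now rewrite !comp_assoc. }
  destruct Hk as (y & Ey).
  destruct (proj2 (T_pb He HW) _ u y) as (d & [<- _] & _); [|apply Im_comp_ge].
  apply (T_mono Hm); now rewrite !comp_assoc, <- !fmap_comp.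
Qed.

Lemma descends_TKer (X Y : C) (g : hom X Y) : descends (TKer g).
Proof. split; [apply ks_TKer|]; exists Y, g; apply (ke_Ker H). Qed.

Lemma descends_meet (X Y W : C) (g : hom X Y) (k : hom W X) :
  descends (meet O (TKer g) (TIm k)).
Proof.
rewrite <- (dir_inv N), inv_TKer; apply descends_dir, descends_TKer.
Qed.

(** Dually to [ks_bot]: the closure of the top is the kernel of some [b], through which the morphism
    to the terminal object [T one] factors. *)
Lemma TKer_one (X : C) (t : hom X one) : TKer t = top O (T X).
Proof.
apply ge_antisym; [|apply top_greatest].
apply ge_trans with (T := ke _ (top O (T X))); [|apply (ke_ge H)].
destruct (ke_normal H (top O (T X))) as (Y & b & <-).
destruct (oneC' Y) as (tY & _ & _), (oneC' (T X)) as (tX & _ & Ht).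
rewrite <- (Ht (fmap T t)), (Ht (tY ∘ b)); trivial; apply Ker_comp_ge.
Qed.

Lemma descends_TIm (X W : C) (k : hom W X) : descends (TIm k).
Proof.
destruct (oneC X) as (t & _ & _).
replace (TIm k) with (meet O (TKer t) (TIm k)); [apply descends_meet|].
apply ge_antisym; [|apply meet_r].
apply meet_greatest; [rewrite TKer_one; apply top_greatest | apply ge_refl].
Qed.

Lemma descends_bot (X : C) : descends (bot O (T X)).
Proof. rewrite <- Ker_id, <- fmap_id; apply descends_TKer. Qed.

Lemma descends_top (X : C) : descends (top O (T X)).
Proof. rewrite <- Im_id, <- fmap_id; apply descends_TIm. Qed.

Lemma descends_ks (X : C) (A : cluster F (T X)) : descends A -> descends (ks (T X) A).
Proof. intros [(W & k & ->) _]; apply descends_TIm. Qed.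

Lemma descends_ke (X : C) (A : cluster F (T X)) : descends A -> descends (ke (T X) A).
Proof. intros [_ (Y & g & ->)]; apply descends_TKer. Qed.

(** The closures of the join are not yet known to come from [C], which is why [TIm_join] and
    [TKer_join] test against all conormal or normal clusters of [F]. *)
Lemma descends_join (X : C) (A B : cluster F (T X)) :
  descends A -> descends B -> descends (join O A B).
Proof.
intros [(V & k & Ek) (Y & g & Eg)] [(W & l & El) (Z & h & Eh)]; split.
- destruct (TIm_join k l) as (S & c & a & b & Ea & Eb & Hc).
  exists S, c; apply ge_antisym.
  + apply Hc; [apply (ks_conormal H) | rewrite <- Ek | rewrite <- El];
      apply op_ge; [apply join_l | apply join_r].
  + rewrite <- (ks_Im H (fmap T c)); apply op_ge, join_least.
    * apply ge_trans with (T := ks _ A); [|apply (ks_ge H)].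
      rewrite Ek, Ea; apply TIm_comp_ge.
    * apply ge_trans with (T := ks _ B); [|apply (ks_ge H)].
      rewrite El, Eb; apply TIm_comp_ge.
- destruct (TKer_join g h) as (S & r & Hg & Hh & Hr).
  exists S, r; apply ge_antisym.
  + apply Hr; [apply (ke_normal H) | rewrite <- Eg | rewrite <- Eh];
      apply op_ge; [apply join_l | apply join_r].
  + rewrite <- (ke_Ker H (fmap T r)); apply op_ge, join_least.
    * apply ge_trans with (T := ke _ A); [|apply (ke_ge H)]; now rewrite Eg.
    * apply ge_trans with (T := ke _ B); [|apply (ke_ge H)]; now rewrite Eh.
Qed.

Lemma inv_TIm_mono (X Y V : C) (m : hom X Y) (n : hom V X) :
  mono m -> inv O (fmap T m) (TIm (m ∘ n)) = TIm n.
Proof.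
intros Hm; rewrite <- dir_TIm, (inv_dir N), (mono_Ker N balC') by now apply T_mono.
apply join_eq_l, bot_least.
Qed.

(** Being below [TIm m], the cluster is [TKer g] met with some [TIm (m ∘ n)]. Its inverse image is
    [TKer (g ∘ m)] met with [TIm n]. *)
Lemma descends_inv_mono (X Y : C) (m : hom X Y) (A : cluster F (T Y)) :
  mono m -> ge (TIm m) A -> descends A -> descends (inv O (fmap T m) A).
Proof.
intros Hm HA [(W & k & Ek) (Z & g & Eg)].
assert (Hk : ge (TIm m) (TIm k)).
{ rewrite <- Ek, <- (ks_Im H (fmap T m)); now apply op_ge. }
apply TIm_factor in Hk; trivial; destruct Hk as (n & ->).
replace A with (meet O (TKer g) (TIm (m ∘ n))).
- rewrite inv_meet, inv_TIm_mono, inv_TKer; trivial; apply descends_meet.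
- rewrite <- Ek, <- Eg; apply ge_antisym.
  + apply meet_greatest; [apply (ke_ge H) | apply (ks_ge H)].
  + apply (ge_of_ks_ke H); [apply meet_r | apply meet_l].
Qed.

(** The inverse image [B] contains the kernel of [T e] and has direct image [A], so its closures are
    the inverse images of those of [A]. For [ks] this is a pullback along an epi, preserved by [T];
    for [ke] it is composition with [e]. *)
Lemma descends_inv_epi (X Y : C) (e : hom X Y) (A : cluster F (T Y)) :
  epi e -> descends A -> descends (inv O (fmap T e) A).
Proof.
intros He [(W & k & Ek) (Z & g & Eg)].
set (B := inv O (fmap T e) A).
assert (HB : ge B (TKer e)) by apply inv_mono, bot_least.
assert (EB : dir O (fmap T e) B = A).
{ unfold B; rewrite (dir_inv N), (epi_Im N balC'); [|now apply T_epi].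
  apply meet_eq_l, top_greatest. }
split.
- destruct (TIm_as_mono k) as (W1 & k1 & Hk1 & Ek1).
  destruct (pbC e k1) as (V & l & w & HV).
  exists V, l; apply ge_antisym.
  (* By (N1) [ks B], which contains the kernel, is the inverse image of its direct image. That
     direct image is itself an image, hence closed, and so contains [ks A]. *)
  + apply ge_trans with (T := inv O (fmap T e) (dir O (fmap T e) (ks (T X) B))).
    * rewrite (inv_dir N), join_eq_l; [apply ge_refl|].
      exact (ge_trans (ks_ge H B) HB).
    * apply inv_greatest, (ge_along_of_dir (O := O)).
      rewrite dir_TIm, (proj1 HV).
      apply ge_trans with (T := TIm k1); [|apply TIm_comp_ge].
      rewrite <- Ek1, <- Ek, <- EB.
      destruct (ks_conormal H B) as (U & u & Eu); rewrite <- Eu, <- Im_comp.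
      rewrite <- (ks_Im H (fmap T e ∘ u)); apply op_ge.
      rewrite Im_comp, Eu; apply dir_mono, (ks_ge H).
  + assert (Hk : ge_along (fmap T e) (TIm k1) (ks (T X) B)).
    { rewrite <- Ek1, <- Ek; apply op_ge, inv_ge. }
    destruct (ks_conormal H B) as (U & u & Eu); rewrite <- Eu in *.
    apply (dir_least O) in Hk; rewrite <- Im_comp in Hk.
    apply (mono_factor N balC') in Hk; [|now apply T_mono].
    destruct Hk as (y & Ey).
    destruct (proj2 (T_pb He HV) _ u y Ey) as (d & [<- _] & _); apply Im_comp_ge.
- exists Z, (g ∘ e); rewrite <- inv_TKer, <- Eg; apply ge_antisym.
  (* Since [ke B] contains the kernel of [T e], it is the kernel of some [c ∘ T e], and [Ker O c]
     contains [A], hence [ke A]. *)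
  + destruct (ke_normal H B) as (V & b & Eb).
    assert (Hb : ge (Ker O b) (TKer e)).
    { rewrite Eb; exact (ge_trans (ke_ge H B) HB). }
    apply (epi_factor N balC') in Hb; [|now apply T_epi]; destruct Hb as (c & ->).
    rewrite <- Eb, Ker_comp; apply inv_mono.
    rewrite <- (ke_Ker H c); apply op_ge; rewrite <- EB.
    apply dir_least, (ge_along_of_inv (O := O)).
    rewrite <- Ker_comp, Eb; apply (ke_ge H).
  + rewrite Eg, inv_TKer, <- (ke_Ker H (fmap T (g ∘ e))); apply op_ge.
    rewrite <- inv_TKer; apply inv_mono; rewrite <- Eg; apply (ke_ge H).
Qed.

Lemma descends_inv (X Y : C) (f : hom X Y) (A : cluster F (T Y)) :
  ge (TIm f) A -> descends A -> descends (inv O (fmap T f) A).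
Proof.
destruct (factorC f) as (J & e & m & He & Hm & ->); intros Hf HA.
rewrite fmap_comp, inv_comp; apply descends_inv_epi; trivial.
apply descends_inv_mono; trivial; now rewrite TIm_epi in Hf.
Qed.

(** The order is decided by the two closures: the kernel part is inverted exactly, the image part by
    a pullback in [C]. The result is largest only among descending clusters. *)
Lemma descends_inv_exists (X Y : C) (f : hom X Y) (A : cluster F (T Y)) :
  descends A -> exists B, descends B /\ ge_along (fmap T f) A B /\
    forall S, descends S -> ge_along (fmap T f) A S -> ge B S.
Proof.
intros [(W & k & Ek) (Z & g & Eg)].
destruct (TIm_inv f k) as (V & l & Hl & Hu).
exists (meet O (TKer (g ∘ f)) (TIm l)); split; [apply descends_meet|split].
- apply (ge_along_of_dir (O := O)), (ge_of_ks_ke H); apply dir_least.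
  + rewrite Ek; exact (ge_along_trans_r Hl (meet_r O _ _)).
  + rewrite Eg; apply (ge_along_of_inv (O := O)).
    rewrite inv_TKer; apply meet_l.
- intros S [(U & u & Eu) _] HS; apply meet_greatest.
  + rewrite <- inv_TKer, <- Eg; apply inv_greatest.
    exact (ge_along_trans_l (ke_ge H A) HS).
  + apply ge_trans with (T := ks _ S); [|apply (ks_ge H)].
    rewrite Eu; apply Hu; rewrite <- Ek, <- Eu; now apply op_ge.
Qed.

Lemma descends_meet_exists (X : C) (A B : cluster F (T X)) :
  descends A -> descends B -> exists M, descends M /\ ge A M /\ ge B M /\
    forall S, descends S -> ge A S -> ge B S -> ge M S.
Proof.
intros [(V & k & Ek) (Y & g & Eg)] [(W & l & El) (Z & h & Eh)].
destruct (TIm_meet k l) as (S & c & Hk & Hl & Hc).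
destruct (TKer_meet g h) as (R & r & Hg & Hh & Hr).
exists (meet O (TKer r) (TIm c)); split; [apply descends_meet|split; [|split]].
- apply (ge_of_ks_ke H); [rewrite Ek | rewrite Eg].
  + exact (ge_trans Hk (meet_r O _ _)).
  + exact (ge_trans Hg (meet_l O _ _)).
- apply (ge_of_ks_ke H); [rewrite El | rewrite Eh].
  + exact (ge_trans Hl (meet_r O _ _)).
  + exact (ge_trans Hh (meet_l O _ _)).
- intros U [(U1 & u & Eu) (U2 & v & Ev)] HA HB; apply meet_greatest.
  + apply ge_trans with (T := ke _ U); [|apply (ke_ge H)].
    rewrite Ev; apply Hr; rewrite <- Ev; [rewrite <- Eg | rewrite <- Eh];
      now apply op_ge.
  + apply ge_trans with (T := ks _ U); [|apply (ks_ge H)].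
    rewrite Eu; apply Hc; rewrite <- Eu; [rewrite <- Ek | rewrite <- El];
      now apply op_ge.
Qed.

(** * The form of descending clusters *)

Notation G := (pb_form descends).
Notation val S := (pb_val S).
Notation mk p := (pb_mk p).

Lemma pb_val_descends X (S : cluster G X) : descends (val S).
Proof. apply pb_valP. Qed.

Lemma pb_orean : inhabited (orean G).
Proof.
assert (gv : forall X Y (f : hom X Y) (U : cluster G Y) S,
  ge_along f U S <-> ge_along (fmap T f) (val U) (val S)) by apply pb_ge_along.
assert (gid : forall X (U S : cluster G X), ge U S <-> ge (val U) (val S))
  by apply pb_ge.
pose proof pb_val_descends as Hd.
apply orean_of_exists.
- intros X; exists (mk (descends_bot X)); intros S; apply gid, bot_least.
- intros X; exists (mk (descends_top X)); intros S; apply gid, top_greatest.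
- intros X S U; exists (mk (descends_join (Hd X S) (Hd X U))); repeat split.
  + apply gid, join_l.
  + apply gid, join_r.
  + intros V H1 H2; apply gid; apply gid in H1, H2; now apply join_least.
- intros X S U.
  destruct (descends_meet_exists (Hd X S) (Hd X U)) as (M & HM & H1 & H2 & H3).
  exists (mk HM); repeat split.
  + now apply gid.
  + now apply gid.
  + intros V H4 H5; apply gid; apply gid in H4, H5; now apply H3.
- intros X Y f S; exists (mk (descends_dir f (Hd X S))); split.
  + apply gv, dir_ge.
  + intros Z g U HU; apply gv; apply gv in HU.
    rewrite fmap_comp in HU; now apply ge_along_dir_comp.
- intros X Y f U.
  destruct (descends_inv_exists f (Hd Y U)) as (B & HB & H1 & H2).
  exists (mk HB); split.
  + now apply gv.
  + intros S HS; apply gid; apply gv in HS; now apply H2.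
Qed.

Section PulledBackOrean.
Context (OG : orean G).

Lemma pb_dir X Y (f : hom X Y) (S : cluster G X) :
  val (dir OG f S) = dir O (fmap T f) (val S).
Proof.
apply ge_antisym; [apply dir_least, pb_ge_along, dir_ge|].
assert (HD : ge (mk (descends_dir f (pb_val_descends S))) (dir OG f S)).
{ apply dir_least, pb_ge_along, dir_ge. }
exact (proj1 (pb_ge _ _) HD).
Qed.

(** In general the inverse image in [G] is only contained in the one in [F]; equality follows once
    the latter is itself a cluster of [G]. *)
Lemma pb_inv X Y (f : hom X Y) (U : cluster G Y) :
  descends (inv O (fmap T f) (val U)) ->
  val (inv OG f U) = inv O (fmap T f) (val U).
Proof.
intros p; apply ge_antisym; [|apply inv_greatest, pb_ge_along, inv_ge].
assert (HD : ge (inv OG f U) (mk p)) by apply inv_greatest, pb_ge_along, inv_ge.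
exact (proj1 (pb_ge _ _) HD).
Qed.

Lemma pb_bot X : val (bot OG X) = bot O (T X).
Proof.
apply ge_antisym; [apply bot_least|].
exact (proj1 (pb_ge _ _) (bot_least OG (mk (descends_bot X)))).
Qed.

Lemma pb_top X : val (top OG X) = top O (T X).
Proof.
apply ge_antisym; [|apply top_greatest].
exact (proj1 (pb_ge _ _) (top_greatest OG (mk (descends_top X)))).
Qed.

Lemma pb_join X (S U : cluster G X) : val (join OG S U) = join O (val S) (val U).
Proof.
apply ge_antisym.
- apply join_least; apply pb_ge; [apply join_l | apply join_r].
- assert (HD : ge (mk (descends_join (pb_val_descends S) (pb_val_descends U)))
                 (join OG S U)).
  { apply join_least; apply pb_ge; [apply join_l | apply join_r]. }
  exact (proj1 (pb_ge _ _) HD).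
Qed.

Lemma pb_Im X Y (f : hom X Y) : val (Im OG f) = TIm f.
Proof. unfold Im; now rewrite pb_dir, pb_top. Qed.

Lemma pb_Ker X Y (f : hom X Y) : val (Ker OG f) = TKer f.
Proof.
unfold Ker; rewrite pb_inv; rewrite pb_bot; trivial.
exact (descends_TKer f).
Qed.

Lemma pb_noetherian : noetherian OG.
Proof.
constructor.
- intros X Y f S; apply pb_val_inj.
  (* The inverse image in [F] is a join with a kernel, so it descends and [pb_inv] applies. *)
  rewrite pb_join, pb_Ker, <- (inv_dir N), <- pb_dir.
  apply pb_inv; rewrite pb_dir, (inv_dir N).
  apply descends_join; [apply pb_val_descends | apply descends_TKer].
- intros X Y f U; apply ge_antisym.
  2:{ apply meet_greatest.
      - apply dir_least, inv_ge.
      - apply dir_mono, top_greatest. }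
  (* The meet in [G] may differ from that in [F], but it lies below [TIm f]. Its inverse image in
     [F] therefore descends and has direct image [M]. *)
  set (M := meet OG U (Im OG f)).
  assert (HM : ge (TIm f) (val M)).
  { rewrite <- pb_Im; apply pb_ge, meet_r. }
  pose proof (descends_inv HM (pb_val_descends M)) as HB.
  apply ge_trans with (T := dir OG f (mk HB)).
  + apply dir_mono, inv_greatest.
    apply ge_along_trans_l with (T := M); [apply meet_l|].
    apply pb_ge_along, inv_ge.
  + apply pb_ge; rewrite pb_dir.
    change (val (mk HB)) with (inv O (fmap T f) (val M)).
    rewrite (dir_inv N), meet_eq_l; trivial; apply ge_refl.
- intros X Y f; destruct (factorC f) as (J & e & m & He & Hm & E).
  exists J, m, e; split; [|split]; trivial.
  + split.
    * apply pb_val_inj; rewrite !pb_Im, E.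
      symmetry; now apply TIm_epi.
    * intros W u Hu; apply pb_ge in Hu.
      rewrite !pb_Im, E, TIm_epi in Hu; trivial.
      destruct (TIm_factor Hm Hu) as (g & Eg).
      exists g; split; trivial.
      intros g' Eg'; apply Hm; now rewrite <- Eg, <- Eg'.
  + split.
    * apply pb_val_inj; rewrite !pb_Ker, E.
      symmetry; now apply TKer_mono.
    * intros W u Hu; apply pb_ge in Hu.
      rewrite !pb_Ker, E, TKer_mono in Hu; trivial.
      destruct (TKer_factor He Hu) as (g & Eg).
      exists g; split; trivial.
      intros g' Eg'; apply He; now rewrite <- Eg, <- Eg'.
- intros X S U (V & g & <-) (W & h & <-).
  destruct (TKer_join g h) as (R & r & Hg & Hh & Hr).
  exists R, r; apply pb_val_inj.
  rewrite pb_join, !pb_Ker; apply ge_antisym; [now apply join_least|].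
  (* By (N3) the join in [F] is normal, so the universal property of [r] applies to it. *)
  apply Hr; [|apply join_l | apply join_r].
  apply (join_normal N); [exists (T V), (fmap T g) | exists (T W), (fmap T h)];
    reflexivity.
- intros X S U (V & k & <-) (W & l & <-).
  destruct (TIm_meet k l) as (R & c & Hk & Hl & Hc).
  exists R, c; apply ge_antisym.
  + apply pb_ge; rewrite pb_Im.
    (* The closure of the meet is an image from [C] and stays below both images, which are
       closed. *)
    destruct (pb_val_descends (meet OG (Im OG k) (Im OG l))) as [(Q & u & Eu) _].
    refine (ge_trans _ (ks_ge H _)); rewrite Eu.
    apply Hc; rewrite <- Eu.
    * rewrite <- (ks_Im H (fmap T k)), <- pb_Im; apply op_ge, pb_ge, meet_l.
    * rewrite <- (ks_Im H (fmap T l)), <- pb_Im; apply op_ge, pb_ge, meet_r.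
  + apply meet_greatest; apply pb_ge; now rewrite !pb_Im.
Qed.

(** The witnesses [k] and [g] in [descends] are exactly what makes the closed clusters of [G] images
    and kernels of morphisms of [C]. *)
Lemma pb_emd_closures :
  emd_closures OG (pb_operator descends_ks) (pb_operator descends_ke).
Proof.
set (Ks := pb_operator descends_ks); set (Ke := pb_operator descends_ke).
assert (vs : forall X (S : cluster G X), val (Ks X S) = ks (T X) (val S)) by reflexivity.
assert (ve : forall X (S : cluster G X), val (Ke X S) = ke (T X) (val S)) by reflexivity.
constructor.
- intros X S; apply pb_ge, (ks_ge H).
- intros X S; apply pb_ge, (ke_ge H).
- intros X S; destruct (pb_val_descends S) as [(W & k & Ek) _].
  exists W, k; apply pb_val_inj; now rewrite pb_Im, vs.
- intros X S; destruct (pb_val_descends S) as [_ (Y & g & Eg)].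
  exists Y, g; apply pb_val_inj; now rewrite pb_Ker, ve.
- intros X Y f; apply pb_val_inj.
  rewrite vs, pb_Im; apply (ks_Im H).
- intros X Y f; apply pb_val_inj.
  rewrite ve, pb_Ker; apply (ke_Ker H).
- intros X Y f S HS; apply pb_ge; rewrite vs, pb_Ker.
  apply (ks_Ker H); rewrite <- pb_bot, <- vs; now apply pb_ge_along.
- intros X S U H1 H2; apply pb_ge; apply (proj1 (pb_ge _ _)) in H1, H2.
  now apply (ge_of_ks_ke H).
Qed.
End PulledBackOrean.

Lemma transfer_emd_noetherian : has_emd_noetherian_form C.
Proof.
destruct pb_orean as [OG].
exists G, OG; split; [exact (pb_noetherian OG)|].
exact (exact_of_emd_closures (pb_emd_closures OG)).
Qed.
End Transfer.

(** * Consequences of balancedness and the theorem *)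

Lemma factor_of_balanced (C : bicategory) :
  orean_bicategory C -> balanced C -> forall (X Y : C) (f : hom X Y),
  exists I (e : hom X I) (m : hom I Y), epi e /\ mono m /\ f = m ∘ e.
Proof.
intros HC [HE HM] X Y f.
destruct (EM_factor (orean_fs HC) f) as (I & e & m & He & Hm & E).
exists I, e, m; split; [now apply HE | split; trivial; now apply HM].
Qed.

(** The inverse is the diagonal of the square with identities on the two other sides. *)
Lemma mono_epi_iso_of_balanced (C : bicategory) :
  orean_bicategory C -> balanced C -> mono_epi_iso C.
Proof.
intros HC [HE HM] X Y f Hm He; apply HM in Hm; apply HE in He.
destruct (EM_diagonal (orean_fs HC) (u := idm X) (v := idm Y) He Hm) as (d & Hd & _).
- now rewrite comp_id_l, comp_id_r.
- now exists d.
Qed.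

Theorem theorem171 (C C' : bicategory)
  (oreanC : orean_bicategory C) (balancedC : balanced C)
  (oreanC' : orean_bicategory C') (balancedC' : balanced C')
  (colimC : has_finite_colimits C) (termC : has_terminal C)
  (pbC : has_pullbacks C)
  (T : functor C C') (T_faithful : faithful T)
  (T_colim : preserves_finite_colimits T) (T_term : preserves_terminal T)
  (T_mono : preserves_monos T) (T_pb : preserves_pullbacks_of_epis T)
  (emdC' : has_emd_noetherian_form C') :
  has_emd_noetherian_form C.
Proof.
destruct emdC' as (F & O & N & K & HK).
pose proof (emd_closures_of_exact HK) as H.
destruct (initial_of_finite_colimits colimC T_colim) as (zero & zeroC & zeroC').
destruct termC as [one oneC].
apply (transfer_emd_noetherian (T := T) N H) with (zero := zero) (one := one);
  trivial.
- now apply mono_epi_iso_of_balanced.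
- now apply mono_epi_iso_of_balanced.
- now apply factor_of_balanced.
- exact (pushout_of_finite_colimits colimC).
- exact (preserves_pushouts T_colim).
- now apply T_term.
Qed.
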